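(* Let ${\sf Atomic}$ be the following formula about a countable partial order $P$ with bottom element $\bot$ (with $a,b,c$ ranging over $P$): $$\forall a\ \exists b\ \forall c\ \big[a>_P\bot\ \to\ (\bot<_P b\le_P a\ \wedge\ \neg(\bot<_P c<_P b))\big].$$ Then ${\sf Atomic}$ is $\forall\forall^\infty$-dicomplete.
   Context: Quantifiers range over $\omega$. $\exists^\infty n\,\varphi(n)$ means $\forall m\exists n\ge m\,\varphi(n)$ and $\forall^\infty n\,\varphi(n)$ means $\exists m\forall n\ge m\,\varphi(n)$. A quantifier-pattern is a finite string $\bar{\mathsf Q}=\mathsf Q_0\dots\mathsf Q_\ell$ over $\{\exists,\forall,\exists^\infty,\forall^\infty\}$. A $\bar{\mathsf Q}$-formula is $\varphi(\bar x)\equiv\mathsf Q_0n_0\dots\mathsf Q_\ell n_\ell\,\theta(n_0,\dots,n_\ell,\bar x)$ with $\theta$ a bounded formula. The instance $\bar x$ is a tuple of natural numbers and/or total computable functions (computable elements of $\omega^\omega$). Spaces such as $\omega\times\omega^\omega$, $(\omega^\omega)^\omega$, $\omega^{\omega\times\omega}$ are identified with $\omega^\omega$ by computable pairing. Witnesses: for $\alpha\in\omega^\omega$, $\alpha\Vdash\varphi(\bar x)$ (''$\alpha$ is a witness for $\varphi(\bar x)$'') is defined by: $\alpha\Vdash\theta(\bar x)$ iff $\alpha=\bar x$ and $\theta(\bar x)$, for bounded $\theta$; $\langle t,\alpha\rangle\Vdash\exists n\varphi(n,\bar x)$ iff $\alpha\Vdash\varphi(t,\bar x)$; $\alpha\Vdash\forall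 n\varphi(n,\bar x)$ iff $\alpha(n)\Vdash\varphi(n,\bar x)$ for all $n$; $\langle t,\alpha\rangle\Vdash\forall^\infty n\varphi(n,\bar x)$ iff $\alpha(n)\Vdash\varphi(n,\bar x)$ for all $n\ge t$; $\alpha\Vdash\exists^\infty n\varphi(n,\bar x)$ iff for all $n$, writing $\alpha(n)=\langle k,\beta\rangle$, $k\ge n$ and $\beta\Vdash\varphi(k,\bar x)$. Reducibility: $\varphi\le_{\sf m}\psi$ if there are computable functions $\eta,r_-,r_+$ (type-two computable functionals, possibly partial but defined wherever required) such that for every instance $\bar x$: $\varphi(\bar x)$ is true iff $\psi(\eta(\bar x))$ is true; $\alpha\Vdash\varphi(\bar x)$ implies $r_-(\alpha,\bar x)\Vdash\psi(\eta(\bar x))$; $\alpha\Vdash\psi(\eta(\bar x))$ implies $r_+(\alpha,\bar x)\Vdash\varphi(\bar x)$ ($\alpha\in\omega^\omega$ arbitrary). The dual $\varphi^{\sf d}$ of $\mathsf Q_0n_0\dots\mathsf Q_\ell n_\ell\,\theta$ is $\mathsf Q_0^{\sf d}n_0\dots\mathsf Q_\ell^{\sf d}n_\ell\,\neg\theta$, where $\exists^{\sf d}=\forall$, $\forall^{\sf d}=\exists$, $(\exists^\infty)^{\sf d}=\forall^\infty$, $(\forall^\infty)^{\sf d}=\exists^\infty$. $\varphi\le_{\sf dm}\psi$ if $\varphi\le_{\sf m}\psi$ and $\varphi^{\sf d}\le_{\sf m}\psi^{\sf d}$ via a common $\eta$ (the $r_\pm$ may differ). $\varphi$ is strictly $\bar{\mathsf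 Q}$-dicomplete if it is a $\bar{\mathsf Q}$-formula and $\psi\le_{\sf dm}\varphi$ for every $\bar{\mathsf Q}$-formula $\psi$; it is $\bar{\mathsf Q}$-dicomplete if it is $\equiv_{\sf dm}$-equivalent to a strictly $\bar{\mathsf Q}$-dicomplete formula (one such is $\mathsf Q_0n_0\dots\mathsf Q_\ell n_\ell.\ x(n_0,\dots,n_\ell)=0$). Structures: a countable binary relation $(X,R)$, $X\subseteq\omega$, $R\subseteq X^2$, is coded by the pair of characteristic functions of $X$ and $R$, and is identified with its code; here the instance is a (computable) code of a partial order $P$ together with its bottom element $\bot$. Reductions from the problem need only work on such instances and reductions to it must output such instances. Quantifiers restricted to $P$ mean $\forall a(a\in P\to\cdots)$, $\exists a(a\in P\wedge\cdots)$, with these decidable conditions moved into the innermost bounded part. *)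

(* Defs.v *)
From Stdlib Require Import Arith List.
From Stdlib Require Cantor.
Import ListNotations.

Definition baire := nat -> nat.

(* Arguments are passed as a list; missing arguments read as 0. *)
Inductive prog : Type :=
| PZero
| PSucc
| PProj (i : nat)
| POracle
| PComp (f : prog) (gs : list prog)
| PRec (f g : prog)
| PMu (f : prog).

(* [eval o p l v]: with oracle [o], the program [p] halts on the arguments [l]
   with value [v].  [PRec f g] sends [n :: l] to [h n l], where [h 0 l = f l] and
   [h (S m) l = g (m :: h m l :: l)]; [PMu f] sends [l] to the least [v] with
   [f (v :: l) = 0], all earlier values of [f] being defined. *)
Fixpoint eval (o : baire) (p : prog) (l : list nat) (v : nat) {struct p} : Prop :=
  match p with
  | PZero => v = 0
  | PSucc => v = S (hd 0 l)
  | PProj i => v = nth i l 0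
  | POracle => v = o (hd 0 l)
  | PComp f gs =>
      exists ws : list nat,
        (fix evals (gs : list prog) (ws : list nat) {struct gs} : Prop :=
           match gs, ws with
           | [], [] => True
           | g :: gs', w :: ws' => eval o g l w /\ evals gs' ws'
           | _, _ => False
           end) gs ws
        /\ eval o f ws v
  | PRec f g =>
      (fix iter (n v : nat) {struct n} : Prop :=
         match n with
         | 0 => eval o f (tl l) v
         | S m => exists w, iter m w /\ eval o g (m :: w :: tl l) v
         end) (hd 0 l) v
  | PMu f =>
      eval o f (v :: l) 0 /\
      forall i, i < v -> exists w, eval o f (i :: l) (S w)
  end.

(* The partial computable functional with program [p] is defined at [x], with
   value [y]. *)
Definition computes (p : prog) (x y : baire) : Prop :=
  forall n, eval x p [n] (y n).

Definition computable (f : baire) : Prop :=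
  exists p, computes p (fun _ => 0) f.

Definition ncons (t : nat) (a : baire) : baire :=
  fun i => match i with 0 => t | S j => a j end.

Definition behead (a : baire) : baire := fun i => a (S i).

Definition bpair (a b : baire) : baire :=
  fun i => if Nat.even i then a (Nat.div2 i) else b (Nat.div2 i).

Definition row (a : baire) (n : nat) : baire := fun i => a (Cantor.to_nat (n, i)).

Definition instance : Type := (list nat * list baire)%type.

Definition code (x : instance) : baire :=
  fold_right ncons (fold_right bpair (fun _ => 0) (snd x)) (fst x).

(* Number variables are de Bruijn indices; function symbols are indices into the
   function part of the instance.  Binary functions are unary functions of a
   pair.  Indices out of range denote 0 and the constant function 0. *)
Inductive term : Type :=
| TVar (i : nat)
| TZero
| TSucc (t : term)
| TAdd (t u : term)
| TMul (t u : term)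
| TPair (t u : term)
| TApp (f : nat) (t : term).

Inductive bformula : Type :=
| BEq (t u : term)
| BLe (t u : term)
| BNot (A : bformula)
| BAnd (A B : bformula)
| BOr (A B : bformula)
| BImp (A B : bformula)
| BAll (t : term) (A : bformula)
| BEx (t : term) (A : bformula).

Fixpoint tval (e : list nat) (fs : list baire) (t : term) : nat :=
  match t with
  | TVar i => nth i e 0
  | TZero => 0
  | TSucc t => S (tval e fs t)
  | TAdd t u => tval e fs t + tval e fs u
  | TMul t u => tval e fs t * tval e fs u
  | TPair t u => Cantor.to_nat (tval e fs t, tval e fs u)
  | TApp f t => nth f fs (fun _ => 0) (tval e fs t)
  end.

(* Bounded quantifiers have non-strict bounds, evaluated outside the binder. *)
Fixpoint bholds (e : list nat) (fs : list baire) (A : bformula) : Prop :=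
  match A with
  | BEq t u => tval e fs t = tval e fs u
  | BLe t u => tval e fs t <= tval e fs u
  | BNot A => ~ bholds e fs A
  | BAnd A B => bholds e fs A /\ bholds e fs B
  | BOr A B => bholds e fs A \/ bholds e fs B
  | BImp A B => bholds e fs A -> bholds e fs B
  | BAll t A => forall n, n <= tval e fs t -> bholds (n :: e) fs A
  | BEx t A => exists n, n <= tval e fs t /\ bholds (n :: e) fs A
  end.

Inductive quantifier : Type := QEx | QAll | QExInf | QAllInf.

(* A formula [Q_0 n_0 ... Q_l n_l. matrix] about tuples of [nnum] numbers and
   [nfun] functions.  In the matrix, the de Bruijn indices 0, ..., l are
   n_0, ..., n_l, followed by the numbers of the instance.  The field [domain]
   singles out the instances the formula is about (all of them, or only the codes
   of structures of some kind). *)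
Record formula : Type := mkFormula {
  prefix : list quantifier;
  matrix : bformula;
  nnum : nat;
  nfun : nat;
  domain : instance -> Prop
}.

Definition is_instance (phi : formula) (x : instance) : Prop :=
  length (fst x) = nnum phi /\ length (snd x) = nfun phi /\
  Forall computable (snd x) /\ domain phi x.

Definition quantify (q : quantifier) (A : nat -> Prop) : Prop :=
  match q with
  | QEx => exists n, A n
  | QAll => forall n, A n
  | QExInf => forall m, exists n, m <= n /\ A n
  | QAllInf => exists m, forall n, m <= n -> A n
  end.

(* [ns] lists the values of the quantified variables already instantiated. *)
Fixpoint holds_from (qs : list quantifier) (th : bformula) (x : instance)
    (ns : list nat) : Prop :=
  match qs with
  | [] => bholds (ns ++ fst x) (snd x) th
  | q :: qs' => quantify q (fun n => holds_from qs' th x (ns ++ [n]))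
  end.

Fixpoint witness_from (qs : list quantifier) (th : bformula) (x : instance)
    (ns : list nat) (a : baire) : Prop :=
  match qs with
  | [] =>
      (forall i, a i = code (ns ++ fst x, snd x) i) /\
      bholds (ns ++ fst x) (snd x) th
  | QEx :: qs' => witness_from qs' th x (ns ++ [a 0]) (behead a)
  | QAll :: qs' => forall n, witness_from qs' th x (ns ++ [n]) (row a n)
  | QAllInf :: qs' =>
      forall n, a 0 <= n -> witness_from qs' th x (ns ++ [n]) (row (behead a) n)
  | QExInf :: qs' =>
      forall n, n <= row a n 0 /\
        witness_from qs' th x (ns ++ [row a n 0]) (behead (row a n))
  end.

Definition holds (phi : formula) (x : instance) : Prop :=
  holds_from (prefix phi) (matrix phi) x [].

Definition witness (phi : formula) (x : instance) (a : baire) : Prop :=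
  witness_from (prefix phi) (matrix phi) x [] a.

Definition qdual (q : quantifier) : quantifier :=
  match q with
  | QEx => QAll | QAll => QEx | QExInf => QAllInf | QAllInf => QExInf
  end.

Definition dual (phi : formula) : formula :=
  mkFormula (map qdual (prefix phi)) (BNot (matrix phi))
    (nnum phi) (nfun phi) (domain phi).

Definition m_reduction (eta rminus rplus : prog) (phi psi : formula) : Prop :=
  forall x, is_instance phi x ->
  exists y, is_instance psi y /\ computes eta (code x) (code y) /\
    (holds phi x <-> holds psi y) /\
    (forall a, witness phi x a ->
       exists b, computes rminus (bpair a (code x)) b /\ witness psi y b) /\
    (forall a, witness psi y a ->
       exists b, computes rplus (bpair a (code x)) b /\ witness phi x b).

Definition m_reducible (phi psi : formula) : Prop :=
  exists eta rminus rplus, m_reduction eta rminus rplus phi psi.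

Definition dm_reducible (phi psi : formula) : Prop :=
  exists eta,
    (exists rminus rplus, m_reduction eta rminus rplus phi psi) /\
    (exists rminus rplus, m_reduction eta rminus rplus (dual phi) (dual psi)).

Definition dm_equivalent (phi psi : formula) : Prop :=
  dm_reducible phi psi /\ dm_reducible psi phi.

Definition strictly_dicomplete (qs : list quantifier) (phi : formula) : Prop :=
  prefix phi = qs /\ forall psi, prefix psi = qs -> dm_reducible psi phi.

Definition dicomplete (qs : list quantifier) (phi : formula) : Prop :=
  exists chi, strictly_dicomplete qs chi /\ dm_equivalent phi chi.

(* An instance is [([bot], [X; R])], with [X] and [R] the characteristic functions
   of the carrier and of the non-strict order relation. *)
Definition is_poset_with_bottom (x : instance) : Prop :=
  let bot := nth 0 (fst x) 0 in
  let X := nth 0 (snd x) (fun _ => 0) in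
  let R := nth 1 (snd x) (fun _ => 0) in
  let P a := X a = 1 in
  let le a b := R (Cantor.to_nat (a, b)) = 1 in
  (forall a, X a <= 1) /\
  (forall i, R i <= 1) /\
  (forall a b, le a b -> P a /\ P b) /\
  (forall a, P a -> le a a) /\
  (forall a b, le a b -> le b a -> a = b) /\
  (forall a b c, le a b -> le b c -> le a c) /\
  P bot /\
  (forall a, P a -> le bot a).

Definition TOne : term := TSucc TZero.
Definition BMem (t : term) : bformula := BEq (TApp 0 t) TOne.
Definition BLeP (t u : term) : bformula := BEq (TApp 1 (TPair t u)) TOne.
Definition BLtP (t u : term) : bformula := BAnd (BLeP t u) (BNot (BEq t u)).

Definition Atomic : formula :=
  let a := TVar 0 in
  let b := TVar 1 in
  let c := TVar 2 in
  let bot := TVar 3 in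
  mkFormula [QAll; QEx; QAll]
    (BImp (BMem a) (BAnd (BMem b) (BImp (BMem c)
       (BImp (BLtP bot a)
          (BAnd (BAnd (BLtP bot b) (BLeP b a))
                (BNot (BAnd (BLtP bot c) (BLtP c b))))))))
    1 2 is_poset_with_bottom.

(* Main.v *)
Require Import Defs.
From Stdlib Require Import List Arith Lia FunctionalExtensionality ClassicalEpsilon.
From Stdlib Require Cantor.
Import ListNotations.

(* The strictly dicomplete formula is [forall n, forall^inf m, y (n, m) = 0].

   From atomicity to eventual zeros: for each element [a] let a candidate [b] run
   through 0, 1, 2, ..., moving on when some [c] below the current stage refutes
   "[b] is an atom below [a]"; let [y (a, s)] be non-zero iff the candidate moves at
   stage [s].  A threshold for [y (a, _)] gives the atom that the candidate has
   reached.  Conversely a choice [B] of an atom below each element decides which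
   elements are atoms, because [b] is an atom iff [B b = b]; hence one can search for
   a stage at which the candidate is correct.

   From eventual zeros to atomicity: below each [n] hang a descending chain with one
   further element for each [m] such that [y (n, m)] is non-zero.

   For the dual formulas, the required numbers are found by unbounded search. *)

(** The obstacle is the threshold for [y (a, _)]. The candidate comes to rest at the least unrefuted
    [b], while a witness names just some correct [b]; whether a smaller number is correct as well is
    a universal question, which a witness of a general forall-exists-forall formula does not answer.
    Atomicity is special in that its witness also speaks about the candidate itself, as an element
    below which an atom is chosen, so that one decidable test replaces the universal question.

    In the converse reduction a chain has an atom iff it is finite, and the index of its atom bounds
    the places where [y (n, _)] is non-zero.

    Each reduction must be a program for a concrete oracle machine. This is kept manageable in two
    ways. Up to its leaves, which are forced, a witness consists of Skolem values, so a translation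
    only has to compute one sequence and at most one further number. And truth is the existence of a
    witness, so translations in both directions already give the equivalence of truth values. *)

Notation pair_code x y := (Cantor.to_nat (x, y)).
Notation pfst n := (fst (Cantor.of_nat n)).
Notation psnd n := (snd (Cantor.of_nat n)).

(** * Uniformly computable functionals *)

(** Made total by choice, so that searches can be written as ordinary functions; the value is
    unspecified if [f] has no zero. *)
Definition mu (f : nat -> nat) : nat :=
  epsilon (inhabits 0) (fun v => f v = 0 /\ forall i, i < v -> f i <> 0).

Lemma mu_spec f :
  (exists v, f v = 0) -> f (mu f) = 0 /\ forall i, i < mu f -> f i <> 0.
Proof.
  intros [v Hv].
  assert (H : exists w, f w = 0 /\ forall i, i < w -> f i <> 0).
  { revert Hv. induction v as [v IH] using lt_wf_ind. intros Hv.
    destruct (classic (exists i, i < v /\ f i = 0)) as [[i [Hi Hfi]] | Hno].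
    - exact (IH i Hi Hfi).
    - exists v. split; [exact Hv |]. intros i Hi Hfi. apply Hno. now exists i. }
  exact (epsilon_spec (inhabits 0) _ H).
Qed.

Lemma mu_unique f v : f v = 0 -> (forall i, i < v -> f i <> 0) -> mu f = v.
Proof.
  intros Hv Hmin. destruct (mu_spec f (ex_intro _ v Hv)) as [H0 H1].
  destruct (lt_eq_lt_dec (mu f) v) as [[H | H] | H].
  - now destruct (Hmin _ H).
  - exact H.
  - now destruct (H1 _ H).
Qed.

Section Effective.

Context {I : Type} (orc : I -> baire).

(* [I] is the type of all admissible inputs of one functional, for instance the
   pairs of an instance and a witness for it, and [orc] their coding as oracles;
   a partial functional thus becomes a total [E], and one program must serve all
   inputs.  [k] is the number of arguments. *)
Definition effective (k : nat) (E : I -> list nat -> nat) : Prop :=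
  exists p, forall i l, length l = k -> eval (orc i) p l (E i l).

Definition effective_seq (k : nat) (A : I -> list nat -> baire) : Prop :=
  effective (S k) (fun i l => A i (tl l) (nth 0 l 0)).

Lemma effective_ext k E E' :
  effective k E -> (forall i l, length l = k -> E' i l = E i l) -> effective k E'.
Proof.
  intros [p Hp] H. exists p. intros i l Hl. rewrite H by exact Hl. now apply Hp.
Qed.

Lemma effective_comp k (Es : list (I -> list nat -> nat)) F :
  effective (length Es) F -> Forall (effective k) Es ->
  effective k (fun i l => F i (map (fun E => E i l) Es)).
Proof.
  intros [p Hp] HEs.
  (* The inner fixpoint of [eval] has no name and is therefore repeated verbatim. *)
  assert (Hgs : exists gs, forall i l, length l = k ->
    (fix evals (gs : list prog) (ws : list nat) {struct gs} : Prop :=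
       match gs, ws with
       | [], [] => True
       | g :: gs', w :: ws' => eval (orc i) g l w /\ evals gs' ws'
       | _, _ => False
       end) gs (map (fun E => E i l) Es)).
  { clear F p Hp. induction HEs as [| E Es [g Hg] _ [gs Hgs]].
    - now exists [].
    - exists (g :: gs). intros i l Hl. split; [now apply Hg | now apply Hgs]. }
  destruct Hgs as [gs Hgs]. exists (PComp p gs). intros i l Hl.
  exists (map (fun E => E i l) Es). split; [now apply Hgs |].
  apply Hp. now rewrite length_map.
Qed.

Lemma effective_nth k j : effective k (fun _ l => nth j l 0).
Proof. exists (PProj j). now intros i l _. Qed.

Lemma effective_succ k E : effective k E -> effective k (fun i l => S (E i l)).
Proof.
  intros HE.
  refine (effective_comp k [E] (fun _ l => S (hd 0 l)) _ _); [| now repeat constructor].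
  exists PSucc. now intros i l _.
Qed.

Lemma effective_const k c : effective k (fun _ _ => c).
Proof.
  induction c as [| c IH]; [exists PZero; now intros i l _ | exact (effective_succ _ _ IH)].
Qed.

Lemma effective_oracle : effective_seq 0 (fun i _ => orc i).
Proof. exists POracle. intros i [| n l] Hl; [discriminate |]. reflexivity. Qed.

Lemma map_nth_seq (l : list nat) : map (fun j => nth j l 0) (seq 0 (length l)) = l.
Proof.
  induction l as [| x l IH]; [reflexivity |]. simpl. f_equal.
  rewrite <- seq_shift, map_map. exact IH.
Qed.

(** Programs have no variables, so a change of variables is a composition with projections: [Es]
    replaces the first [d] arguments and [Ps] passes on the other [k]. Weakening and the insertion
    of an argument are the cases of an empty and a one-element [Es]. *)
Lemma effective_args d k (Es : list (I -> list nat -> nat)) F :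
  effective (length Es + k) F -> Forall (effective (d + k)) Es ->
  effective (d + k) (fun i l => F i (map (fun E => E i l) Es ++ skipn d l)).
Proof.
  intros HF HEs.
  set (Ps := map (fun j (_ : I) (l : list nat) => nth j l 0) (seq d k)).
  refine (effective_ext _ _ _ (effective_comp (d + k) (Es ++ Ps) F _ _) _).
  - unfold Ps. now rewrite length_app, length_map, length_seq.
  - apply Forall_app. split; [exact HEs |].
    apply Forall_map, Forall_forall. intros j _. apply effective_nth.
  - intros i l Hl. rewrite map_app. f_equal. f_equal. unfold Ps. rewrite map_map.
    rewrite <- (map_nth_seq (skipn d l)), length_skipn, Hl.
    (* The index lists get the starting points [d + s] and [s], which makes induction on [k]
       possible. *)
    replace (d + k - d) with k by lia. rewrite <- (Nat.add_0_r d) at 1.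
    clear. generalize 0 at 2 4. induction k as [| k IH]; intros s; simpl; [reflexivity |].
    now rewrite nth_skipn, IH, Nat.add_succ_r.
Qed.

Lemma effective_tl k E : effective k E -> effective (S k) (fun i l => E i (tl l)).
Proof. intros HE. exact (effective_args 1 k [] E HE (Forall_nil _)). Qed.

(** Argument 1 is dropped; in the step of a recursion this is the previous value. *)
Lemma effective_tl_second k F :
  effective (S k) (fun i l => F i (nth 0 l 0) (tl l)) ->
  effective (S (S k)) (fun i l => F i (nth 0 l 0) (tl (tl l))).
Proof.
  intros HF.
  refine (effective_ext _ _ _ (effective_args 2 k [fun _ l => nth 0 l 0] _ HF _) _).
  - repeat constructor. apply effective_nth.
  - intros i [| x [| y l]] Hl; try discriminate. reflexivity.
Qed.

Lemma effective_cons k E F :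
  effective (S k) F -> effective k E -> effective k (fun i l => F i (E i l :: l)).
Proof.
  intros HF HE. exact (effective_args 0 k [E] F HF (Forall_cons _ HE (Forall_nil _))).
Qed.

Lemma effective_rec k F G N :
  effective k F ->
  effective (S (S k)) (fun i l => G i (nth 0 l 0) (nth 1 l 0) (tl (tl l))) ->
  effective k N ->
  effective k (fun i l => nat_rect (fun _ => nat) (F i l) (fun m w => G i m w l) (N i l)).
Proof.
  intros [p Hp] [q Hq] HN.
  refine (effective_cons k N (fun i l =>
    nat_rect (fun _ => nat) (F i (tl l)) (fun m w => G i m w (tl l)) (hd 0 l)) _ HN).
  exists (PRec p q). intros i [| n l] Hl; [discriminate |]. injection Hl as Hl.
  simpl. induction n as [| n IH].
  - now apply Hp.
  - eexists. split; [exact IH |]. apply (Hq i (n :: _ :: l)). simpl. now rewrite Hl.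
Qed.

Lemma effective_match k N F G :
  effective k N -> effective k F ->
  effective (S k) (fun i l => G i (nth 0 l 0) (tl l)) ->
  effective k (fun i l => match N i l with 0 => F i l | S m => G i m l end).
Proof.
  intros HN HF HG.
  refine (effective_ext _ _ _ (effective_rec k F (fun i m _ l => G i m l) N HF _ HN) _).
  - now apply effective_tl_second.
  - intros i l _. now destruct (N i l).
Qed.

(** The one place where termination is at stake. Since [I] contains admissible inputs only, the
    existence of a zero may be derived from the correctness of a witness. *)
Lemma effective_mu k F :
  effective (S k) (fun i l => F i (nth 0 l 0) (tl l)) ->
  (forall i l, exists v, F i v l = 0) ->
  effective k (fun i l => mu (fun v => F i v l)).
Proof.
  intros [p Hp] Hex. exists (PMu p). intros i l Hl.
  destruct (mu_spec _ (Hex i l)) as [H0 H1]. split.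
  - rewrite <- H0. apply (Hp i (_ :: l)). simpl. now rewrite Hl.
  - intros j Hj. specialize (H1 j Hj). exists (pred (F i j l)).
    rewrite Nat.succ_pred by exact H1. apply (Hp i (_ :: l)). simpl. now rewrite Hl.
Qed.

Lemma effective_pred k E : effective k E -> effective k (fun i l => pred (E i l)).
Proof.
  intros HE.
  refine (effective_ext _ _ _ (effective_match k E (fun _ _ => 0) (fun _ m _ => m) HE
    (effective_const k 0) (effective_nth (S k) 0)) _).
  intros i l _. now destruct (E i l).
Qed.

Lemma effective_add k E F :
  effective k E -> effective k F -> effective k (fun i l => E i l + F i l).
Proof.
  intros HE HF.
  refine (effective_ext _ _ _ (effective_rec k F (fun _ _ w _ => S w) E HF _ HE) _).
  - apply effective_succ, effective_nth.
  - intros i l _. induction (E i l); simpl; congruence.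
Qed.

Lemma effective_mul k E F :
  effective k E -> effective k F -> effective k (fun i l => E i l * F i l).
Proof.
  intros HE HF.
  refine (effective_ext _ _ _
    (effective_rec k (fun _ _ => 0) (fun i _ w l => F i l + w) E _ _ HE) _).
  - apply effective_const.
  - apply effective_add; [| apply effective_nth]. exact (effective_tl _ _ (effective_tl _ _ HF)).
  - intros i l _. induction (E i l); simpl; congruence.
Qed.

Lemma effective_sub k E F :
  effective k E -> effective k F -> effective k (fun i l => E i l - F i l).
Proof.
  intros HE HF.
  refine (effective_ext _ _ _ (effective_rec k E (fun _ _ w _ => pred w) F HE _ HF) _).
  - apply effective_pred, effective_nth.
  - intros i l _. induction (F i l); simpl; lia.
Qed.

(** [Cantor.to_nat] is by definition the second component plus a triangular number, and the latter
    is a primitive recursion. *)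
Lemma effective_pair k E F :
  effective k E -> effective k F -> effective k (fun i l => pair_code (E i l) (F i l)).
Proof.
  intros HE HF.
  refine (effective_add k F (fun i l =>
    nat_rect (fun _ => nat) 0 (fun m w => S m + w) (F i l + E i l)) HF _).
  refine (effective_rec k (fun _ _ => 0) (fun _ m w _ => S m + w)
    (fun i l => F i l + E i l) _ _ _).
  - apply effective_const.
  - apply effective_add; [apply effective_succ |]; apply effective_nth.
  - now apply effective_add.
Qed.

End Effective.

(** * Unpairing *)

Lemma pair_code_diag x y : pair_code x y = y + pair_code (x + y) 0.
Proof.
  unfold Cantor.to_nat. rewrite (Nat.add_comm x y). reflexivity.
Qed.

Lemma pair_code_diag_succ d : pair_code (S d) 0 = S d + pair_code d 0.
Proof. reflexivity. Qed.

Lemma pair_code_diag_mono d e : d <= e -> pair_code d 0 <= pair_code e 0.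
Proof. induction 1; [lia |]. rewrite pair_code_diag_succ. lia. Qed.

(** Pairs with sum [d] have consecutive codes from [pair_code d 0] on, so the diagonal of [n] is the
    least [d] for which the next diagonal starts above [n]. This turns unpairing into a search. *)
Lemma of_nat_sum n :
  pfst n + psnd n = mu (fun d => S n - pair_code (S d) 0).
Proof.
  symmetry. pose proof (Cantor.cancel_to_of n) as Hn.
  destruct (Cantor.of_nat n) as [x y]. simpl fst; simpl snd.
  rewrite pair_code_diag in Hn. apply mu_unique.
  - rewrite pair_code_diag_succ. lia.
  - intros d Hd. pose proof (pair_code_diag_mono (S d) (x + y) Hd). lia.
Qed.

Section EffectivePairs.

Context {I : Type} (orc : I -> baire).

Lemma effective_of_nat_sum k E :
  effective orc k E -> effective orc k (fun i l => pfst (E i l) + psnd (E i l)).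
Proof.
  intros HE.
  refine (effective_ext _ _ _ _ (effective_mu orc k
    (fun i d l => S (E i l) - pair_code (S d) 0) _ _) _).
  - apply effective_sub; [exact (effective_succ _ _ _ (effective_tl _ _ _ HE)) |].
    apply effective_pair; [apply effective_succ, effective_nth | apply effective_const].
  - intros i l. exists (pfst (E i l) + psnd (E i l)).
    rewrite of_nat_sum. apply (mu_spec (fun d => S (E i l) - pair_code (S d) 0)).
    exists (E i l). pose proof (Cantor.to_nat_non_decreasing (S (E i l)) 0). lia.
  - intros i l _. apply of_nat_sum.
Qed.

(** The second component is the distance of the code from the start of its diagonal. *)
Lemma effective_psnd k E :
  effective orc k E -> effective orc k (fun i l => psnd (E i l)).
Proof.
  intros HE.
  refine (effective_ext _ _ _ _ (effective_sub orc k E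
    (fun i l => pair_code (pfst (E i l) + psnd (E i l)) 0) HE _) _).
  - apply effective_pair; [now apply effective_of_nat_sum | apply effective_const].
  - intros i l _. pose proof (Cantor.cancel_to_of (E i l)) as Hn.
    destruct (Cantor.of_nat (E i l)) as [x y]. rewrite pair_code_diag in Hn. simpl in *. lia.
Qed.

Lemma effective_pfst k E :
  effective orc k E -> effective orc k (fun i l => pfst (E i l)).
Proof.
  intros HE.
  refine (effective_ext _ _ _ _ (effective_sub orc k
    (fun i l => pfst (E i l) + psnd (E i l)) (fun i l => psnd (E i l)) _ _) _).
  - now apply effective_of_nat_sum.
  - now apply effective_psnd.
  - intros i l _. lia.
Qed.

End EffectivePairs.

(** * Sequences coded by rows, pairs and prefixed numbers *)

Definition unrow (F : nat -> baire) : baire := fun i => F (pfst i) (psnd i).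

Lemma row_unrow F n : row (unrow F) n = F n.
Proof.
  apply functional_extensionality. intros i. unfold row, unrow.
  now rewrite Cantor.cancel_of_to.
Qed.

Lemma bpair_even a b n : bpair a b (2 * n) = a n.
Proof.
  unfold bpair. now rewrite Nat.even_even, Nat.div2_double.
Qed.

Lemma bpair_odd a b n : bpair a b (S (2 * n)) = b n.
Proof.
  unfold bpair. rewrite Nat.div2_succ_double.
  replace (S (2 * n)) with (2 * n + 1) by lia. now rewrite Nat.even_odd.
Qed.

Section Sequences.

Context {I : Type} (orc : I -> baire).

Definition effective_fun (B : I -> baire) : Prop := effective_seq orc 0 (fun i _ => B i).

Lemma effective_fun_intro B :
  effective orc 1 (fun i l => B i (nth 0 l 0)) -> effective_fun B.
Proof. intros H; exact H. Qed.

Lemma effective_fun_app B k E :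
  effective_fun B -> effective orc k E -> effective orc k (fun i l => B i (E i l)).
Proof.
  intros HB HE.
  exact (effective_comp orc k [E] (fun i l => B i (nth 0 l 0)) HB
    (Forall_cons _ HE (Forall_nil _))).
Qed.

Lemma effective_fun_seq B k : effective_fun B -> effective_seq orc k (fun i _ => B i).
Proof. intros HB. exact (effective_fun_app B _ _ HB (effective_nth orc (S k) 0)). Qed.

Lemma effective_nth_tl k j : effective orc k (fun _ l => nth j (tl l) 0).
Proof.
  refine (effective_ext _ _ _ _ (effective_nth orc k (S j)) _).
  intros _ [| x l] _; [now destruct j | reflexivity].
Qed.

Lemma effective_nth_tl_tl k j : effective orc k (fun _ l => nth j (tl (tl l)) 0).
Proof.
  refine (effective_ext _ _ _ _ (effective_nth orc k (S (S j))) _).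
  intros _ [| x [| y l]] _; try reflexivity; now destruct j.
Qed.

Lemma effective_unrow k F :
  effective_seq orc (S k) (fun i l => F i (nth 0 l 0) (tl l)) ->
  effective_seq orc k (fun i l => unrow (fun n => F i n l)).
Proof.
  intros HF. unfold effective_seq.
  refine (effective_ext _ _ _ _ (effective_args orc 1 k
    [fun _ l => psnd (nth 0 l 0); fun _ l => pfst (nth 0 l 0)] _ HF _) _).
  - repeat constructor; [apply effective_psnd | apply effective_pfst]; apply effective_nth.
  - reflexivity.
Qed.

Lemma effective_bpair k A B :
  effective_seq orc k A -> effective_seq orc k B ->
  effective_seq orc k (fun i l => bpair (A i l) (B i l)).
Proof.
  assert (Hsub : forall C H, effective_seq orc k C -> effective orc (S k) H ->
    effective orc (S k) (fun i l => C i (tl l) (H i l))).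
  { intros C H HC HH.
    exact (effective_args orc 1 k [H] _ HC (Forall_cons _ HH (Forall_nil _))). }
  intros HA HB.
  (* Parity and halving as primitive recursions: [half] increases on leaving an odd number. *)
  set (odd := fun n => nat_rect (fun _ => nat) 0 (fun _ w => 1 - w) n).
  set (half := fun n => nat_rect (fun _ => nat) 0 (fun m w => w + odd m) n).
  assert (Hodd : forall m E, effective orc m E -> effective orc m (fun i l => odd (E i l))).
  { intros m E HE. apply (effective_rec orc m (fun _ _ => 0) (fun _ _ w _ => 1 - w));
      [apply effective_const | | exact HE].
    apply effective_sub; [apply effective_const | apply effective_nth]. }
  assert (Hhalf : forall m E, effective orc m E -> effective orc m (fun i l => half (E i l))).
  { intros m E HE. apply (effective_rec orc m (fun _ _ => 0) (fun _ m w _ => w + odd m));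
      [apply effective_const | | exact HE].
    apply effective_add; [apply effective_nth | apply Hodd, effective_nth]. }
  assert (Hspec : forall n, odd n = (if Nat.even n then 0 else 1) /\ half n = Nat.div2 n).
  { induction n as [| n [IH1 IH2]]; [now split |].
    change (odd (S n)) with (1 - odd n). change (half (S n)) with (half n + odd n).
    rewrite IH1, IH2. rewrite Nat.even_succ, <- Nat.negb_even.
    split; [now destruct (Nat.even n) |].
    pose proof (Nat.div2_odd n) as E1. pose proof (Nat.div2_odd (S n)) as E2.
    rewrite Nat.odd_succ in E2. rewrite <- Nat.negb_even in E1.
    destruct (Nat.even n); cbn [negb Nat.b2n] in E1, E2; lia. }
  refine (effective_ext _ _ _ _ (effective_match orc (S k)
    (fun _ l => odd (nth 0 l 0)) (fun i l => A i (tl l) (half (nth 0 l 0)))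
    (fun i _ l => B i (tl l) (half (nth 0 l 0))) _ _ _) _).
  - apply Hodd, effective_nth.
  - apply (Hsub A); [exact HA | apply Hhalf, effective_nth].
  - apply (effective_tl orc (S k) (fun i l => B i (tl l) (half (nth 0 l 0)))).
    apply (Hsub B); [exact HB | apply Hhalf, effective_nth].
  - intros i l _. destruct (Hspec (nth 0 l 0)) as [-> ->]. unfold bpair.
    now destruct (Nat.even (nth 0 l 0)).
Qed.

Lemma effective_ncons k E A :
  effective orc k E -> effective_seq orc k A ->
  effective_seq orc k (fun i l => ncons (E i l) (A i l)).
Proof.
  intros HE HA. unfold effective_seq.
  refine (effective_match orc (S k) (fun _ l => nth 0 l 0) (fun i l => E i (tl l))
    (fun i m l => A i (tl l) m) _ (effective_tl _ _ _ HE) _).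
  - apply effective_nth.
  - now apply (effective_tl_second orc k (fun i m l => A i l m)).
Qed.

End Sequences.

(** Follows the syntax of the function; the last case applies a sequence that a hypothesis declares
    effective. *)
Ltac effective_step :=
  lazymatch goal with
  | |- effective _ _ (fun _ _ => ?c) => apply effective_const
  | |- effective _ _ (fun _ l => nth ?j l 0) => apply effective_nth
  | |- effective _ _ (fun _ l => nth ?j (tl l) 0) => apply effective_nth_tl
  | |- effective _ _ (fun _ l => nth ?j (tl (tl l)) 0) => apply effective_nth_tl_tl
  | |- effective _ _ (fun _ _ => S _) => apply effective_succ
  | |- effective _ _ (fun _ _ => pred _) => apply effective_pred
  | |- effective _ _ (fun _ _ => _ + _) => apply effective_add
  | |- effective _ _ (fun _ _ => _ * _) => apply effective_mul
  | |- effective _ _ (fun _ _ => _ - _) => apply effective_sub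
  | |- effective _ _ (fun _ _ => pair_code _ _) => apply effective_pair
  | |- effective _ _ (fun _ _ => pfst _) => apply effective_pfst
  | |- effective _ _ (fun _ _ => psnd _) => apply effective_psnd
  | |- effective _ _ (fun i l => match @?N i l with 0 => @?F i l | S m => @?G i l m end) =>
      apply (effective_match _ _ N F (fun i m l => G i l m))
  | |- effective_fun _ _ => apply effective_fun_intro
  | |- _ =>
      match goal with
      | H : effective_fun _ _ |- _ => apply (effective_fun_app _ _ _ _ H)
      end
  end.

Ltac effectivity := repeat (cbv beta; effective_step).

(** * Bounded formulas *)

(** The range includes [N], in accordance with the non-strict bounds of [bholds]. A sum vanishes iff
    all terms do, a product iff some factor does: these are the two bounded quantifiers when truth
    is 0. *)
Definition bsum (f : nat -> nat) (N : nat) : nat :=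
  nat_rect (fun _ => nat) (f 0) (fun m w => w + f (S m)) N.

Definition bprod (f : nat -> nat) (N : nat) : nat :=
  nat_rect (fun _ => nat) (f 0) (fun m w => w * f (S m)) N.

Lemma bsum_zero f N : bsum f N = 0 <-> forall n, n <= N -> f n = 0.
Proof.
  induction N as [| N IH]; simpl.
  - split; [intros H n Hn; now replace n with 0 by lia | auto].
  - change (nat_rect _ _ _ N) with (bsum f N). rewrite Nat.eq_add_0, IH. split.
    + intros [H1 H2] n Hn. destruct (Nat.eq_dec n (S N)) as [-> |]; [exact H2 | apply H1; lia].
    + intros H. split; [intros n Hn |]; apply H; lia.
Qed.

Lemma bprod_zero f N : bprod f N = 0 <-> exists n, n <= N /\ f n = 0.
Proof.
  induction N as [| N IH]; simpl.
  - split; [intros H; now exists 0 | intros [n [Hn H]]; apply Nat.le_0_r in Hn; now subst n].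
  - change (nat_rect _ _ _ N) with (bprod f N). rewrite Nat.eq_mul_0, IH. split.
    + intros [[n [Hn H]] | H]; [exists n | exists (S N)]; auto.
    + intros [n [Hn H]]. destruct (Nat.eq_dec n (S N)) as [-> |]; [now right | left].
      exists n. split; [lia | exact H].
Qed.

(* Truth is coded by 0, so that conjunction is addition. *)
Fixpoint bchar (e : list nat) (fs : list baire) (A : bformula) : nat :=
  match A with
  | BEq t u => (tval e fs t - tval e fs u) + (tval e fs u - tval e fs t)
  | BLe t u => tval e fs t - tval e fs u
  | BNot A => 1 - bchar e fs A
  | BAnd A B => bchar e fs A + bchar e fs B
  | BOr A B => bchar e fs A * bchar e fs B
  | BImp A B => (1 - bchar e fs A) * bchar e fs B
  | BAll t A => bsum (fun n => bchar (n :: e) fs A) (tval e fs t)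
  | BEx t A => bprod (fun n => bchar (n :: e) fs A) (tval e fs t)
  end.

Lemma bchar_zero A : forall e fs, bchar e fs A = 0 <-> bholds e fs A.
Proof.
  induction A as [t u | t u | A IH | A IHA B IHB | A IHA B IHB | A IHA B IHB | t A IH | t A IH];
    intros e fs; cbn [bchar bholds].
  - lia.
  - lia.
  - rewrite <- IH. lia.
  - rewrite <- IHA, <- IHB. lia.
  - rewrite <- IHA, <- IHB. apply Nat.eq_mul_0.
  - rewrite <- IHA, <- IHB, Nat.eq_mul_0. lia.
  - rewrite bsum_zero. split; intros H n Hn; apply IH; auto.
  - rewrite bprod_zero. split; intros [n [Hn H]]; exists n; split; auto; now apply IH.
Qed.

(** * Deciding bounded formulas uniformly in the instance *)

Section Instances.

Context {I : Type} (orc : I -> baire).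

Lemma effective_bounded (op : nat -> nat -> nat) k F N :
  (forall k E F, effective orc k E -> effective orc k F ->
     effective orc k (fun i l => op (E i l) (F i l))) ->
  effective orc (S k) (fun i l => F i (nth 0 l 0) (tl l)) -> effective orc k N ->
  effective orc k (fun i l =>
    nat_rect (fun _ => nat) (F i 0 l) (fun m w => op w (F i (S m) l)) (N i l)).
Proof.
  intros Hop HF HN. apply (effective_rec orc k (fun i l => F i 0 l)
    (fun i m w l => op w (F i (S m) l)) N); [| | exact HN].
  - exact (effective_cons orc k _ _ HF (effective_const orc k 0)).
  - apply Hop; [apply effective_nth |].
    refine (effective_ext _ _ _ _ (effective_args orc 2 k [fun _ l => S (nth 0 l 0)] _ HF _) _).
    + repeat constructor. apply effective_succ, effective_nth.
    + intros i [| x [| y l]] Hl; try discriminate. reflexivity.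
Qed.

Lemma effective_bsum k F N :
  effective orc (S k) (fun i l => F i (nth 0 l 0) (tl l)) -> effective orc k N ->
  effective orc k (fun i l => bsum (fun n => F i n l) (N i l)).
Proof. exact (effective_bounded Nat.add k F N (effective_add orc)). Qed.

Lemma effective_bprod k F N :
  effective orc (S k) (fun i l => F i (nth 0 l 0) (tl l)) -> effective orc k N ->
  effective orc k (fun i l => bprod (fun n => F i n l) (N i l)).
Proof. exact (effective_bounded Nat.mul k F N (effective_mul orc)). Qed.

Context (x : I -> instance) (nums funs : nat).
Hypothesis length_nums : forall i, length (fst (x i)) = nums.
Hypothesis length_funs : forall i, length (snd (x i)) = funs.
Hypothesis effective_code : effective_fun orc (fun i => code (x i)).

Lemma effective_instance_num k j : effective orc k (fun i _ => nth j (fst (x i)) 0).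
Proof.
  destruct (lt_dec j nums) as [Hj | Hj].
  - refine (effective_ext _ _ _ _
      (effective_fun_app orc _ k _ effective_code (effective_const orc k j)) _).
    intros i l _. rewrite <- (length_nums i) in Hj. unfold code.
    revert Hj. generalize j. induction (fst (x i)) as [| t ts IH]; intros [| j'] Hj;
      simpl in *; try lia. apply IH. lia.
  - refine (effective_ext _ _ _ _ (effective_const orc k 0) _).
    intros i l _. apply nth_overflow. rewrite length_nums. lia.
Qed.

(** A code does not record lengths; positions in it are computable because all instances considered
    have [nums] numbers and [funs] functions. *)
Lemma effective_instance_fun j :
  effective_fun orc (fun i => nth j (snd (x i)) (fun _ => 0)).
Proof.
  destruct (lt_dec j funs) as [Hj | Hj].
  (* In the nested pairs, function [j] is the left half of what remains after [j] steps to the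
     right. *)
  - set (pos := fun m => nat_rect (fun _ => nat) (2 * m) (fun _ w => S (2 * w)) j).
    refine (effective_ext _ _ _ _
      (effective_fun_app orc _ 1 (fun _ l => nums + pos (nth 0 l 0)) effective_code _) _).
    + apply effective_add; [apply effective_const |].
      apply (effective_rec orc 1 (fun _ l => 2 * nth 0 l 0) (fun _ _ w _ => S (2 * w))
        (fun _ _ => j)); effectivity.
    + intros i l _. rewrite <- (length_funs i) in Hj. rewrite <- (length_nums i).
      unfold code. generalize (nth 0 l 0) as m. intros m.
      transitivity (fold_right bpair (fun _ => 0) (snd (x i)) (pos m)).
      2:{ now induction (fst (x i)). }
      unfold pos. clear pos. revert j Hj.
      induction (snd (x i)) as [| f fs IH]; intros [| j] Hj; simpl length in Hj; try lia.
      * symmetry. apply bpair_even.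
      * cbn [nat_rect fold_right nth]. rewrite bpair_odd. apply IH. lia.
  - refine (effective_ext _ _ _ _ (effective_const orc 1 0) _).
    intros i l _. now rewrite nth_overflow by (rewrite length_funs; lia).
Qed.

Lemma effective_tval t k :
  effective orc k (fun i l => tval (l ++ fst (x i)) (snd (x i)) t).
Proof.
  induction t as [j | | t IH | t IHt u IHu | t IHt u IHu | t IHt u IHu | f t IH]; cbn [tval].
  - destruct (lt_dec j k) as [Hj | Hj].
    + refine (effective_ext _ _ _ _ (effective_nth orc k j) _).
      intros i l <-. now apply app_nth1.
    + refine (effective_ext _ _ _ _ (effective_instance_num k (j - k)) _).
      intros i l <-. apply app_nth2. lia.
  - apply effective_const.
  - now apply effective_succ.
  - now apply effective_add.
  - now apply effective_mul.
  - now apply effective_pair.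
  - exact (effective_fun_app orc _ k _ (effective_instance_fun f) IH).
Qed.

Lemma effective_bchar A k :
  effective orc k (fun i l => bchar (l ++ fst (x i)) (snd (x i)) A).
Proof.
  assert (Hbinder : forall A k,
    effective orc (S k) (fun i l => bchar (l ++ fst (x i)) (snd (x i)) A) ->
    effective orc (S k) (fun i l =>
      bchar (nth 0 l 0 :: tl l ++ fst (x i)) (snd (x i)) A)).
  { intros B m HB. refine (effective_ext _ _ _ _ HB _).
    intros i [| y l] Hl; [discriminate | reflexivity]. }
  revert k.
  induction A as [t u | t u | A IH | A IHA B IHB | A IHA B IHB | A IHA B IHB | t A IH | t A IH];
    intros k; cbn [bchar].
  - apply effective_add; apply effective_sub; apply effective_tval.
  - apply effective_sub; apply effective_tval.
  - apply effective_sub; [apply effective_const | apply IH].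
  - now apply effective_add.
  - now apply effective_mul.
  - apply effective_mul; [apply effective_sub; [apply effective_const |] |]; auto.
  - exact (effective_bsum k (fun i n l => bchar (n :: l ++ fst (x i)) (snd (x i)) A) _
      (Hbinder A k (IH (S k))) (effective_tval t k)).
  - exact (effective_bprod k (fun i n l => bchar (n :: l ++ fst (x i)) (snd (x i)) A) _
      (Hbinder A k (IH (S k))) (effective_tval t k)).
Qed.

End Instances.

(** * Witnesses and reductions *)

Lemma behead_ncons t a : behead (ncons t a) = a.
Proof. reflexivity. Qed.

(** Witnesses need not be computable, so countable choice assembles them from their rows. *)
Lemma holds_iff_witness qs th x : forall ns,
  holds_from qs th x ns <-> exists a, witness_from qs th x ns a.
Proof.
  induction qs as [| q qs IH]; intros ns.
  { simpl. split; [intros H; eexists; split; [reflexivity | exact H] | now intros [a [_ H]]]. }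
  assert (Hrows : forall P : nat -> baire -> Prop,
    (forall n, exists a, P n a) -> exists a, forall n, P n (row a n)).
  { intros P HP.
    exists (unrow (fun n => proj1_sig (constructive_indefinite_description _ (HP n)))).
    intros n. rewrite row_unrow.
    exact (proj2_sig (constructive_indefinite_description _ (HP n))). }
  destruct q; simpl.
  - split.
    + intros [n Hn]. apply IH in Hn as [a Ha]. now exists (ncons n a).
    + intros [a Ha]. exists (a 0). apply IH. eauto.
  - split.
    + intros H. apply (Hrows (fun n => witness_from qs th x (ns ++ [n]))). intros n. now apply IH.
    + intros [a Ha] n. apply IH. eauto.
  - split.
    + intros H.
      apply (Hrows (fun n b => n <= b 0 /\ witness_from qs th x (ns ++ [b 0]) (behead b))).
      intros m. destruct (H m) as [n [Hmn Hn]]. apply IH in Hn as [a Ha].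
      now exists (ncons n a).
    + intros [a Ha] m. destruct (Ha m) as [Hm Hw]. exists (row a m 0). split; [exact Hm |].
      apply IH. eauto.
  - split.
    + intros [m Hm].
      destruct (Hrows (fun n b => m <= n -> witness_from qs th x (ns ++ [n]) b)) as [a Ha].
      { intros n. destruct (le_dec m n) as [Hn | Hn].
        - destruct (proj1 (IH _) (Hm n Hn)) as [b Hb]. now exists b.
        (* Rows below the threshold are unconstrained. *)
        - exists (fun _ => 0). now intros H. }
      exists (ncons m a). exact Ha.
    + intros [a Ha]. exists (a 0). intros n Hn. apply IH. eauto.
Qed.

(** Quantifying over all [I] and [orc] allows [h] to be used inside any functional whose oracle
    computes the instance, whatever else that oracle contains. *)
Definition effective_map (D : instance -> Prop) (h : instance -> baire) : Prop :=
  forall (I : Type) (orc : I -> baire) (x : I -> instance),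
    (forall i, D (x i)) -> effective_fun orc (fun i => code (x i)) ->
    effective_fun orc (fun i => h (x i)).

(** [W] is a promise: only for correct witnesses does [g] have to be computed, so its searches may
    fail elsewhere. *)
Definition effective_on (D : instance -> Prop) (W : instance -> baire -> Prop)
    (g : instance -> baire -> baire) : Prop :=
  forall (I : Type) (orc : I -> baire) (x : I -> instance) (a : I -> baire),
    (forall i, D (x i)) -> (forall i, W (x i) (a i)) ->
    effective_fun orc (fun i => code (x i)) -> effective_fun orc a ->
    effective_fun orc (fun i => g (x i) (a i)).

Definition translates (D : instance -> Prop) (W W' : instance -> baire -> Prop) : Prop :=
  exists g, effective_on D W g /\ forall x a, D x -> W x a -> W' x (g x a).

(** A single program results from taking as inputs the type [J] of all pairs of an instance and a
    correct witness, with the oracle prescribed by [m_reduction]. *)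
Lemma translates_program D W W' :
  translates D W W' ->
  exists r, forall x a, D x -> W x a ->
    exists b, computes r (bpair a (code x)) b /\ W' x b.
Proof.
  intros [g [Heff Hg]].
  set (J := {xa : instance * baire | D (fst xa) /\ W (fst xa) (snd xa)}).
  set (x := fun i : J => fst (proj1_sig i)). set (a := fun i : J => snd (proj1_sig i)).
  set (orc := fun i : J => bpair (a i) (code (x i))).
  assert (Horc : effective_fun orc orc) by exact (effective_oracle orc).
  destruct (Heff J orc x a) as [r Hr].
  - intros i. apply (proj2_sig i).
  - intros i. apply (proj2_sig i).
  - refine (effective_ext _ _ _ _
      (effective_fun_app orc orc 1 (fun _ l => S (2 * nth 0 l 0)) Horc _) _); [effectivity |].
    intros i l _. symmetry. apply bpair_odd.
  - refine (effective_ext _ _ _ _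
      (effective_fun_app orc orc 1 (fun _ l => 2 * nth 0 l 0) Horc _) _); [effectivity |].
    intros i l _. symmetry. apply bpair_even.
  - exists r. intros z b Hz Hb. exists (g z b). split; [| now apply Hg].
    intros n. exact (Hr (exist _ (z, b) (conj Hz Hb)) [n] eq_refl).
Qed.

(** A formula and its dual have the same instances, so one program [eta] for [h] serves both
    reductions. *)
Lemma dm_reducible_intro phi psi (h : instance -> instance) :
  let D := is_instance phi in
  effective_map D (fun x => code (h x)) ->
  (forall x, D x -> is_instance psi (h x)) ->
  translates D (witness phi) (fun x => witness psi (h x)) ->
  translates D (fun x => witness psi (h x)) (witness phi) ->
  translates D (witness (dual phi)) (fun x => witness (dual psi) (h x)) ->
  translates D (fun x => witness (dual psi) (h x)) (witness (dual phi)) ->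
  dm_reducible phi psi.
Proof.
  intros D Heff Hinst H1 H2 H3 H4.
  set (J := {x : instance | D x}). set (x := fun i : J => proj1_sig i).
  destruct (Heff J (fun i => code (x i)) x (fun i => proj2_sig i)) as [eta Heta].
  { exact (effective_oracle (fun i => code (x i))). }
  assert (Hred : forall phi' psi',
    (forall z, is_instance phi' z <-> D z) ->
    (forall z, is_instance psi' z <-> is_instance psi z) ->
    translates D (witness phi') (fun x => witness psi' (h x)) ->
    translates D (fun x => witness psi' (h x)) (witness phi') ->
    exists rminus rplus, m_reduction eta rminus rplus phi' psi').
  { intros phi' psi' Hphi Hpsi Hm Hp.
    apply translates_program in Hm as [rm Hm]. apply translates_program in Hp as [rp Hp].
    exists rm, rp. intros z Hz. apply Hphi in Hz. exists (h z).
    split; [now apply Hpsi, Hinst |].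
    split; [intros n; exact (Heta (exist _ z Hz) [n] eq_refl) |].
    split; [| split; intros a Ha; [exact (Hm z a Hz Ha) | exact (Hp z a Hz Ha)]].
    unfold holds. rewrite !holds_iff_witness. split; intros [a Ha].
    - destruct (Hm z a Hz Ha) as [b [_ Hb]]. now exists b.
    - destruct (Hp z a Hz Ha) as [b [_ Hb]]. now exists b. }
  exists eta. split; apply Hred; try assumption; intros z; reflexivity.
Qed.

(** A fixed computable instance is effective over the zero oracle, with [unit] as the type of
    inputs. This supplies the computability required of the instances put out. *)
Lemma effective_map_computable D h x :
  effective_map D h -> D x -> Forall computable (snd x) -> computable (h x).
Proof.
  intros Hh Hx Hcomp.
  destruct (Hh unit (fun _ _ => 0) (fun _ => x) (fun _ => Hx)) as [p Hp].
  - assert (Hfs : effective_fun (fun (_ : unit) _ => 0)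
      (fun _ => fold_right bpair (fun _ => 0) (snd x))).
    { induction Hcomp as [| f fs [p Hp] _ IH].
      - exact (effective_const _ 1 0).
      - apply (effective_bpair _ 0 (fun _ _ => f)); [| exact IH].
        exists p. intros i [| n [| m l]] Hl; try discriminate. apply Hp. }
    unfold code. induction (fst x) as [| t ts IH]; [exact Hfs |].
    exact (effective_ncons _ 0 (fun _ _ => t) _ (effective_const _ 0 t) IH).
  - exists p. intros n. exact (Hp tt [n] eq_refl).
Qed.

(** * Witnesses for the four prefixes as Skolem values *)

Section Shapes.

Context (th : bformula).

Definition matrix_holds (x : instance) (ns : list nat) : Prop :=
  bholds (ns ++ fst x) (snd x) th.

Definition all_cofin_witness (x : instance) (T : baire) : baire :=
  unrow (fun n => ncons (T n) (unrow (fun m => code ([n; m] ++ fst x, snd x)))).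

Definition ex_inf_witness (x : instance) (n : nat) (K : baire) : baire :=
  ncons n (unrow (fun m => ncons (K m) (code ([n; K m] ++ fst x, snd x)))).

Definition all_ex_all_witness (x : instance) (B : baire) : baire :=
  unrow (fun a => ncons (B a) (unrow (fun c => code ([a; B a; c] ++ fst x, snd x)))).

Definition ex_all_ex_witness (x : instance) (a : nat) (C : baire) : baire :=
  ncons a (unrow (fun b => ncons (C b) (code ([a; b; C b] ++ fst x, snd x)))).

(** The threshold under [[QAll; QAllInf]] and the choice under [[QAll; QEx; QAll]]; for the dual
    prefixes it is applied after [behead] has removed the outer existential value. *)
Definition skolem (w : baire) : baire := fun n => row w n 0.

Lemma all_cofin_intro x T :
  (forall n m, T n <= m -> matrix_holds x [n; m]) ->
  witness_from [QAll; QAllInf] th x [] (all_cofin_witness x T).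
Proof.
  intros H n. unfold all_cofin_witness. rewrite row_unrow. intros m Hm.
  rewrite behead_ncons, row_unrow. split; [reflexivity | now apply H].
Qed.

Lemma all_cofin_elim x w :
  witness_from [QAll; QAllInf] th x [] w ->
  forall n m, skolem w n <= m -> matrix_holds x [n; m].
Proof. intros H n m Hm. exact (proj2 (H n m Hm)). Qed.

Lemma ex_inf_intro x n K :
  (forall m, m <= K m /\ matrix_holds x [n; K m]) ->
  witness_from [QEx; QExInf] th x [] (ex_inf_witness x n K).
Proof.
  intros H m. unfold ex_inf_witness. rewrite behead_ncons, row_unrow.
  split; [apply H |]. split; [reflexivity | apply H].
Qed.

Lemma ex_inf_elim x w :
  witness_from [QEx; QExInf] th x [] w ->
  forall m, m <= skolem (behead w) m /\ matrix_holds x [w 0; skolem (behead w) m].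
Proof. intros H m. exact (conj (proj1 (H m)) (proj2 (proj2 (H m)))). Qed.

Lemma all_ex_all_intro x B :
  (forall a c, matrix_holds x [a; B a; c]) ->
  witness_from [QAll; QEx; QAll] th x [] (all_ex_all_witness x B).
Proof.
  intros H a. unfold all_ex_all_witness. rewrite row_unrow. intros c.
  rewrite behead_ncons, row_unrow. split; [reflexivity | apply H].
Qed.

Lemma all_ex_all_elim x w :
  witness_from [QAll; QEx; QAll] th x [] w ->
  forall a c, matrix_holds x [a; skolem w a; c].
Proof. intros H a c. exact (proj2 (H a c)). Qed.

Lemma ex_all_ex_intro x a C :
  (forall b, matrix_holds x [a; b; C b]) ->
  witness_from [QEx; QAll; QEx] th x [] (ex_all_ex_witness x a C).
Proof.
  intros H b. unfold ex_all_ex_witness. rewrite behead_ncons, row_unrow.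
  split; [reflexivity | apply H].
Qed.

Lemma ex_all_ex_elim x w :
  witness_from [QEx; QAll; QEx] th x [] w ->
  forall b, matrix_holds x [w 0; b; skolem (behead w) b].
Proof. intros H b. exact (proj2 (H b)). Qed.

End Shapes.

Section EffectiveShapes.

Context {I : Type} (orc : I -> baire) (x : I -> instance).
Hypothesis effective_code : effective_fun orc (fun i => code (x i)).

Lemma effective_code_app k (Ns : list (I -> list nat -> nat)) :
  Forall (effective orc k) Ns ->
  effective_seq orc k (fun i l => code (map (fun N => N i l) Ns ++ fst (x i), snd (x i))).
Proof.
  intros HNs. induction HNs as [| N Ns HN _ IH].
  - exact (effective_fun_seq orc _ k effective_code).
  - exact (effective_ncons orc k N _ HN IH).
Qed.

Lemma effective_skolem w : effective_fun orc w -> effective_fun orc (fun i => skolem (w i)).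
Proof. intros Hw. unfold skolem, row. effectivity. Qed.

Lemma effective_behead w : effective_fun orc w -> effective_fun orc (fun i => behead (w i)).
Proof. intros Hw. unfold behead. effectivity. Qed.

Lemma effective_all_cofin T :
  effective_fun orc T -> effective_fun orc (fun i => all_cofin_witness (x i) (T i)).
Proof.
  intros HT.
  refine (effective_unrow orc 0 (fun i n _ => ncons (T i n)
    (unrow (fun m => code ([n; m] ++ fst (x i), snd (x i))))) _).
  refine (effective_ncons orc 1 (fun i l => T i (nth 0 l 0)) _ _ _); [effectivity |].
  refine (effective_unrow orc 1 (fun i m l =>
    code ([nth 0 l 0; m] ++ fst (x i), snd (x i))) _).
  refine (effective_code_app 2 [fun _ l => nth 0 (tl l) 0; fun _ l => nth 0 l 0] _).
  repeat constructor; effectivity.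
Qed.

Lemma effective_ex_inf n K :
  effective orc 0 (fun i _ => n i) -> effective_fun orc K ->
  effective_fun orc (fun i => ex_inf_witness (x i) (n i) (K i)).
Proof.
  intros Hn HK. apply effective_ncons; [exact Hn |].
  refine (effective_unrow orc 0 (fun i m _ => ncons (K i m)
    (code ([n i; K i m] ++ fst (x i), snd (x i)))) _).
  refine (effective_ncons orc 1 (fun i l => K i (nth 0 l 0)) _ _ _); [effectivity |].
  refine (effective_code_app 1 [fun i _ => n i; fun i l => K i (nth 0 l 0)] _).
  repeat constructor; [exact (effective_tl orc 0 _ Hn) | effectivity].
Qed.

Lemma effective_all_ex_all B :
  effective_fun orc B -> effective_fun orc (fun i => all_ex_all_witness (x i) (B i)).
Proof.
  intros HB.
  refine (effective_unrow orc 0 (fun i a _ => ncons (B i a)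
    (unrow (fun c => code ([a; B i a; c] ++ fst (x i), snd (x i))))) _).
  refine (effective_ncons orc 1 (fun i l => B i (nth 0 l 0)) _ _ _); [effectivity |].
  refine (effective_unrow orc 1 (fun i c l =>
    code ([nth 0 l 0; B i (nth 0 l 0); c] ++ fst (x i), snd (x i))) _).
  refine (effective_code_app 2 [fun _ l => nth 0 (tl l) 0;
    fun i l => B i (nth 0 (tl l) 0); fun _ l => nth 0 l 0] _).
  repeat constructor; effectivity.
Qed.

Lemma effective_ex_all_ex a C :
  effective orc 0 (fun i _ => a i) -> effective_fun orc C ->
  effective_fun orc (fun i => ex_all_ex_witness (x i) (a i) (C i)).
Proof.
  intros Ha HC. apply effective_ncons; [exact Ha |].
  refine (effective_unrow orc 0 (fun i b _ => ncons (C i b)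
    (code ([a i; b; C i b] ++ fst (x i), snd (x i)))) _).
  refine (effective_ncons orc 1 (fun i l => C i (nth 0 l 0)) _ _ _); [effectivity |].
  refine (effective_code_app 1 [fun i _ => a i; fun _ l => nth 0 l 0;
    fun i l => C i (nth 0 l 0)] _).
  repeat constructor; [exact (effective_tl orc 0 _ Ha) | effectivity | effectivity].
Qed.

End EffectiveShapes.

(** * Translations given by Skolem values *)

Section Translations.

Context (D : instance -> Prop) (W : instance -> baire -> Prop).
Context (th : bformula) (h : instance -> instance).
Hypothesis effective_h : effective_map D (fun x => code (h x)).

(** [effective_on] speaks of sequences only; a number is treated as a constant sequence and read off
    at 0. *)
Lemma effective_on_number (n : instance -> baire -> nat)
    (I : Type) (orc : I -> baire) (x : I -> instance) (a : I -> baire) :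
  effective_fun orc (fun i _ => n (x i) (a i)) -> effective orc 0 (fun i _ => n (x i) (a i)).
Proof. intros Hn. exact (effective_cons orc 0 _ _ Hn (effective_const orc 0 0)). Qed.

Lemma translates_all_cofin (T : instance -> baire -> baire) :
  effective_on D W T ->
  (forall x a, D x -> W x a -> forall n m, T x a n <= m -> matrix_holds th (h x) [n; m]) ->
  translates D W (fun x => witness_from [QAll; QAllInf] th (h x) []).
Proof.
  intros HT H. exists (fun x a => all_cofin_witness (h x) (T x a)). split.
  - intros I orc x a Hx Ha Hcx Hca.
    apply (effective_all_cofin orc (fun i => h (x i)) (effective_h I orc x Hx Hcx)
      (fun i => T (x i) (a i))). now apply HT.
  - intros x a Hx Ha. apply all_cofin_intro. now apply H.
Qed.

Lemma translates_ex_inf (n : instance -> baire -> nat) (K : instance -> baire -> baire) :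
  effective_on D W (fun x a _ => n x a) -> effective_on D W K ->
  (forall x a, D x -> W x a ->
     forall m, m <= K x a m /\ matrix_holds th (h x) [n x a; K x a m]) ->
  translates D W (fun x => witness_from [QEx; QExInf] th (h x) []).
Proof.
  intros Hn HK H. exists (fun x a => ex_inf_witness (h x) (n x a) (K x a)). split.
  - intros I orc x a Hx Ha Hcx Hca.
    apply (effective_ex_inf orc (fun i => h (x i)) (effective_h I orc x Hx Hcx)
      (fun i => n (x i) (a i)) (fun i => K (x i) (a i))); [| now apply HK].
    apply effective_on_number. now apply Hn.
  - intros x a Hx Ha. apply ex_inf_intro. now apply H.
Qed.

Lemma translates_all_ex_all (B : instance -> baire -> baire) :
  effective_on D W B ->
  (forall x w, D x -> W x w -> forall a c, matrix_holds th (h x) [a; B x w a; c]) ->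
  translates D W (fun x => witness_from [QAll; QEx; QAll] th (h x) []).
Proof.
  intros HB H. exists (fun x a => all_ex_all_witness (h x) (B x a)). split.
  - intros I orc x a Hx Ha Hcx Hca.
    apply (effective_all_ex_all orc (fun i => h (x i)) (effective_h I orc x Hx Hcx)
      (fun i => B (x i) (a i))). now apply HB.
  - intros x a Hx Ha. apply all_ex_all_intro. now apply H.
Qed.

Lemma translates_ex_all_ex (n : instance -> baire -> nat) (C : instance -> baire -> baire) :
  effective_on D W (fun x a _ => n x a) -> effective_on D W C ->
  (forall x w, D x -> W x w -> forall b, matrix_holds th (h x) [n x w; b; C x w b]) ->
  translates D W (fun x => witness_from [QEx; QAll; QEx] th (h x) []).
Proof.
  intros Hn HC H. exists (fun x a => ex_all_ex_witness (h x) (n x a) (C x a)). split.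
  - intros I orc x a Hx Ha Hcx Hca.
    apply (effective_ex_all_ex orc (fun i => h (x i)) (effective_h I orc x Hx Hcx)
      (fun i => n (x i) (a i)) (fun i => C (x i) (a i))); [| now apply HC].
    apply effective_on_number. now apply Hn.
  - intros x a Hx Ha. apply ex_all_ex_intro. now apply H.
Qed.

End Translations.

Lemma effective_map_id D : effective_map D (fun x => code x).
Proof. intros I orc x _ H. exact H. Qed.

Lemma effective_on_skolem D W : effective_on D W (fun _ w => skolem w).
Proof. intros I orc x a _ _ _ Ha. now apply effective_skolem. Qed.

Lemma effective_on_skolem_behead D W : effective_on D W (fun _ w => skolem (behead w)).
Proof. intros I orc x a _ _ _ Ha. now apply effective_skolem, effective_behead. Qed.

Lemma effective_on_head D W : effective_on D W (fun _ w _ => w 0).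
Proof.
  intros I orc x a _ _ _ Ha. unfold effective_fun, effective_seq. effectivity.
Qed.

(** * A strictly dicomplete formula *)

Definition cofin_zero_matrix : bformula := BEq (TApp 0 (TPair (TVar 0) (TVar 1))) TZero.

Definition cofin_zero : formula :=
  mkFormula [QAll; QAllInf] cofin_zero_matrix 0 1 (fun _ => True).

Definition binary (y : baire) : instance := ([], [y]).

Lemma cofin_zero_holds y n m :
  matrix_holds cofin_zero_matrix (binary y) [n; m] <-> y (pair_code n m) = 0.
Proof. reflexivity. Qed.

Lemma reducible_to_cofin_zero phi (y : instance -> baire) :
  let D := is_instance phi in
  let h x := binary (y x) in
  effective_map D y ->
  (effective_map D (fun x => code (h x)) ->
    translates D (witness phi) (fun x => witness cofin_zero (h x)) /\
    translates D (fun x => witness cofin_zero (h x)) (witness phi) /\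
    translates D (witness (dual phi)) (fun x => witness (dual cofin_zero) (h x)) /\
    translates D (fun x => witness (dual cofin_zero) (h x)) (witness (dual phi))) ->
  dm_reducible phi cofin_zero.
Proof.
  intros D h Hy H.
  assert (Hh : effective_map D (fun x => code (h x))).
  { intros I orc x Hx Hcode.
    exact (effective_bpair orc 0 (fun i _ => y (x i)) (fun _ _ _ => 0)
      (Hy I orc x Hx Hcode) (effective_const orc 1 0)). }
  destruct (H Hh) as (H1 & H2 & H3 & H4).
  apply (dm_reducible_intro phi cofin_zero h); try assumption.
  intros x Hx. split; [reflexivity |]. split; [reflexivity |]. split; [| exact Logic.I].
  repeat constructor. apply (effective_map_computable D); [exact Hy | exact Hx | apply Hx].
Qed.

Definition matrix_char (phi : formula) (x : instance) (ns : list nat) : nat :=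
  bchar (ns ++ fst x) (snd x) (matrix phi).

Lemma matrix_char_zero phi x ns :
  matrix_char phi x ns = 0 <-> matrix_holds (matrix phi) x ns.
Proof. apply bchar_zero. Qed.

Lemma effective_matrix_char phi (I : Type) (orc : I -> baire) x k
    (Ns : list (I -> list nat -> nat)) :
  (forall i, is_instance phi (x i)) -> effective_fun orc (fun i => code (x i)) ->
  Forall (effective orc k) Ns ->
  effective orc k (fun i l => matrix_char phi (x i) (map (fun N => N i l) Ns)).
Proof.
  intros Hx Hcode HNs.
  exact (effective_comp orc k Ns _ (effective_bchar orc x (nnum phi) (nfun phi)
    (fun i => proj1 (Hx i)) (fun i => proj1 (proj2 (Hx i))) Hcode (matrix phi) (length Ns)) HNs).
Qed.

(** The matrix of [psi] is decidable relative to the instance. With its characteristic function as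
    [y], the two matrices are equivalent, and all four translations leave the Skolem values
    unchanged. *)
Lemma cofin_zero_strictly_dicomplete : strictly_dicomplete [QAll; QAllInf] cofin_zero.
Proof.
  split; [reflexivity |]. intros psi Hpre.
  set (y := fun x k => matrix_char psi x [pfst k; psnd k]).
  assert (Hy : forall x n m, y x (pair_code n m) = 0 <-> matrix_holds (matrix psi) x [n; m]).
  { intros x n m. unfold y. rewrite Cantor.cancel_of_to. apply matrix_char_zero. }
  apply (reducible_to_cofin_zero psi y).
  { intros I orc x Hx Hcode. apply effective_fun_intro.
    apply (effective_matrix_char psi I orc x 1
      [fun _ l => pfst (nth 0 l 0); fun _ l => psnd (nth 0 l 0)] Hx Hcode).
    repeat constructor; effectivity. }
  intros Hh. unfold witness, dual. cbn [prefix matrix]. rewrite Hpre.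
  cbn [map qdual prefix cofin_zero].
  split; [| split; [| split]].
  - apply (translates_all_cofin _ _ _ _ Hh (fun _ => skolem)); [apply effective_on_skolem |].
    intros x w _ Hw n m Hm. apply Hy. exact (all_cofin_elim _ _ _ Hw n m Hm).
  - apply (translates_all_cofin _ _ _ (fun x => x) (effective_map_id _) (fun _ => skolem));
      [apply effective_on_skolem |].
    intros x w _ Hw n m Hm. apply Hy. exact (all_cofin_elim _ _ _ Hw n m Hm).
  - apply (translates_ex_inf _ _ _ _ Hh (fun _ w => w 0) (fun _ w => skolem (behead w)));
      [apply effective_on_head | apply effective_on_skolem_behead |].
    intros x w _ Hw m. destruct (ex_inf_elim _ _ _ Hw m) as [Hm Hnot].
    split; [exact Hm |]. intros Hzero. apply Hnot, Hy, Hzero.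
  - apply (translates_ex_inf _ _ _ (fun x => x) (effective_map_id _)
      (fun _ w => w 0) (fun _ w => skolem (behead w)));
      [apply effective_on_head | apply effective_on_skolem_behead |].
    intros x w _ Hw m. destruct (ex_inf_elim _ _ _ Hw m) as [Hm Hnot].
    split; [exact Hm |]. intros Hzero. apply Hnot, Hy, Hzero.
Qed.

(** * Reducing atomicity to eventual zeros *)

Section Candidates.

Context (theta : nat -> nat -> nat).

Definition refutation (b s : nat) : nat := bsum (fun c => theta b c) s.

(** [1 - (1 - x)] is the sign of [x], so the candidate moves by exactly one and skips no value. *)
Definition candidate (s : nat) : nat :=
  nat_rect (fun _ => nat) 0 (fun s b => b + (1 - (1 - refutation b s))) s.

Definition jump (s : nat) : nat := refutation (candidate s) s.

Definition unrefuted (b : nat) : Prop := forall c, theta b c = 0.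

Lemma candidate_succ s : candidate (S s) = candidate s + (1 - (1 - jump s)).
Proof. reflexivity. Qed.

Lemma candidate_mono s t : s <= t -> candidate s <= candidate t.
Proof. induction 1 as [| t _ IH]; [lia |]. rewrite candidate_succ. lia. Qed.

(** The candidate starts at 0, moves in steps of one and leaves a value only upon a refutation. *)
Lemma refuted_of_lt_candidate s b : b < candidate s -> exists c, theta b c <> 0.
Proof.
  induction s as [| s IH]; [intros H; inversion H |].
  rewrite candidate_succ. intros Hb.
  destruct (lt_dec b (candidate s)) as [Hlt | Hge]; [exact (IH Hlt) |].
  apply NNPP. intros Hno.
  assert (H0 : jump s = 0).
  { apply bsum_zero. intros c _. replace (candidate s) with b by lia.
    apply NNPP. intros Hc. apply Hno. now exists c. }
  lia.
Qed.

(** The candidate stays the same from [t] on, and at stage [t + c] it is tested against every number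
    up to [t + c], in particular against [c]. *)
Lemma unrefuted_of_no_jump t :
  (forall s, t <= s -> jump s = 0) -> unrefuted (candidate t).
Proof.
  intros Ht c.
  assert (Hstable : forall s, t <= s -> candidate s = candidate t).
  { intros s Hs. induction Hs as [| s Hs IH]; [reflexivity |].
    rewrite candidate_succ, (Ht s Hs). lia. }
  specialize (Ht (t + c) (Nat.le_add_r t c)). unfold jump in Ht.
  rewrite Hstable in Ht by lia. apply (proj1 (bsum_zero _ _) Ht). lia.
Qed.

Lemma no_jump_of_unrefuted t :
  unrefuted (candidate t) -> forall s, t <= s -> jump s = 0.
Proof.
  intros Ht s Hs.
  assert (H : candidate s = candidate t /\ jump s = 0); [| apply H].
  assert (Hjump : forall s, candidate s = candidate t -> jump s = 0).
  { intros u Hu. unfold jump. rewrite Hu. apply bsum_zero. intros c _. apply Ht. }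
  induction Hs as [| s Hs [IH1 IH2]]; [auto |].
  assert (candidate (S s) = candidate t) by (rewrite candidate_succ; lia). auto.
Qed.

(** Each jump raises the candidate, so it eventually passes every [b]. *)
Lemma refuted_of_jumps :
  (forall t, exists s, t <= s /\ jump s <> 0) -> forall b, exists c, theta b c <> 0.
Proof.
  intros Hinf b.
  assert (H : exists s, b < candidate s).
  { induction b as [| b [s Hs]].
    - destruct (Hinf 0) as [s [_ Hs]]. exists (S s). rewrite candidate_succ. lia.
    - destruct (Hinf s) as [t [Hst Ht]]. exists (S t). rewrite candidate_succ.
      pose proof (candidate_mono s t Hst). lia. }
  destruct H as [s Hs]. exact (refuted_of_lt_candidate s b Hs).
Qed.

(** Otherwise there would be jumps beyond every stage, and [b] would be refuted. The classical
    argument suffices, as it only has to guarantee that a search ends. *)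
Lemma candidate_reaches b : unrefuted b -> exists t, unrefuted (candidate t).
Proof.
  intros Hb. apply NNPP. intros Hno. destruct (refuted_of_jumps) with (b := b) as [c Hc].
  - intros t. apply NNPP. intros Hjump. apply Hno. exists t. apply unrefuted_of_no_jump.
    intros s Hs. apply NNPP. intros Hs'. apply Hjump. now exists s.
  - apply Hc, Hb.
Qed.

Lemma jumps_of_refuted :
  (forall b, exists c, theta b c <> 0) -> forall t, exists s, jump (t + s) <> 0.
Proof.
  intros Href t. apply NNPP. intros Hno. destruct (Href (candidate t)) as [c Hc].
  apply Hc, unrefuted_of_no_jump. intros s Hs. apply NNPP. intros Hs'. apply Hno.
  exists (s - t). now replace (t + (s - t)) with s by lia.
Qed.

End Candidates.

(** * The matrix of atomicity and its candidates *)

Definition atomic_at (x : instance) (a b c : nat) : Prop :=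
  let bot := nth 0 (fst x) 0 in
  let X := nth 0 (snd x) (fun _ => 0) in
  let R := nth 1 (snd x) (fun _ => 0) in
  let lt a b := R (pair_code a b) = 1 /\ a <> b in
  X a = 1 -> X b = 1 /\ (X c = 1 -> lt bot a ->
    (lt bot b /\ R (pair_code b a) = 1) /\ ~ (lt bot c /\ lt c b)).

Lemma atomic_at_iff x a b c :
  matrix_holds (matrix Atomic) x [a; b; c] <-> atomic_at x a b c.
Proof. reflexivity. Qed.

(* Given a choice [B] of atoms, [b] is itself an atom iff [B b] does not refute it. *)
Lemma atomic_at_choice x B :
  is_poset_with_bottom x -> (forall a c, atomic_at x a (B a) c) ->
  forall a b, atomic_at x a b (B b) -> forall c, atomic_at x a b c.
Proof.
  intros (_ & _ & Hdom & _ & Hanti & Htrans & Hbot & Hleast) HB a b Hb c Ha.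
  destruct (Hb Ha) as [HbX Hb']. split; [exact HbX |]. intros HcX Hlt.
  destruct (HB b c HbX) as [HBX HBb].
  destruct (Hb' HBX Hlt) as [[Hbpos Hba] Hnot].
  destruct (HBb HcX Hbpos) as [[HBpos HBle] HBatom].
  split; [now split |]. intros [Hc1 Hc2].
  destruct (Nat.eq_dec (B b) b) as [Heq | Hne].
  - rewrite Heq in HBatom. apply HBatom. now split.
  (* Here [B b] lies strictly between the bottom and [b], against the test of [b] at [B b]. *)
  - apply Hnot. now split.
Qed.

Definition atomic_theta (x : instance) (a b c : nat) : nat := matrix_char Atomic x [a; b; c].

Lemma atomic_theta_zero x a b c : atomic_theta x a b c = 0 <-> atomic_at x a b c.
Proof. apply matrix_char_zero. Qed.

Definition first_nonzero_from (f : baire) : baire :=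
  fun k => k + mu (fun j => 1 - f (k + j)).

Lemma first_nonzero_from_spec f k :
  (exists j, f (k + j) <> 0) ->
  k <= first_nonzero_from f k /\ f (first_nonzero_from f k) <> 0.
Proof.
  intros [j Hj]. destruct (mu_spec (fun j => 1 - f (k + j))) as [H _]; [exists j; lia |].
  unfold first_nonzero_from. lia.
Qed.

Lemma effective_first_nonzero_from (I : Type) (orc : I -> baire) (f : I -> baire) :
  effective_fun orc f -> (forall i k, exists j, f i (k + j) <> 0) ->
  effective_fun orc (fun i => first_nonzero_from (f i)).
Proof.
  intros Hf Hex. apply effective_fun_intro. unfold first_nonzero_from.
  apply effective_add; [effectivity |].
  apply (effective_mu orc 1 (fun i j l => 1 - f i (nth 0 l 0 + j))).
  - effectivity.
  - intros i l. destruct (Hex i (nth 0 l 0)) as [j Hj]. exists j. lia.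
Qed.

Definition atomic_jump (x : instance) (a : nat) : baire := jump (atomic_theta x a).

Section EffectiveAtomic.

Context {I : Type} (orc : I -> baire) (x : I -> instance).
Hypothesis instances : forall i, is_instance Atomic (x i).
Hypothesis effective_code : effective_fun orc (fun i => code (x i)).

Lemma effective_atomic_theta m A B C :
  effective orc m A -> effective orc m B -> effective orc m C ->
  effective orc m (fun i l => atomic_theta (x i) (A i l) (B i l) (C i l)).
Proof.
  intros HA HB HC.
  apply (effective_matrix_char Atomic I orc x m [A; B; C] instances effective_code).
  now repeat constructor.
Qed.

Lemma effective_refutation m A B S' :
  effective orc m A -> effective orc m B -> effective orc m S' ->
  effective orc m (fun i l => refutation (atomic_theta (x i) (A i l)) (B i l) (S' i l)).
Proof.
  intros HA HB HS.
  apply (effective_bsum orc m (fun i c l => atomic_theta (x i) (A i l) (B i l) c) S'); [| exact HS].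
  apply effective_atomic_theta; [exact (effective_tl _ _ _ HA) | exact (effective_tl _ _ _ HB) |].
  apply effective_nth.
Qed.

Lemma effective_candidate m A S' :
  effective orc m A -> effective orc m S' ->
  effective orc m (fun i l => candidate (atomic_theta (x i) (A i l)) (S' i l)).
Proof.
  intros HA HS. apply (effective_rec orc m (fun _ _ => 0)
    (fun i s b l => b + (1 - (1 - refutation (atomic_theta (x i) (A i l)) b s))) S');
    [apply effective_const | | exact HS].
  assert (effective orc (S (S m)) (fun i l =>
    refutation (atomic_theta (x i) (A i (tl (tl l)))) (nth 1 l 0) (nth 0 l 0))).
  { apply (effective_refutation (S (S m)) (fun i l => A i (tl (tl l))));
      [| apply effective_nth | apply effective_nth].
    exact (effective_tl _ _ _ (effective_tl _ _ _ HA)). }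
  effectivity; assumption.
Qed.

Lemma effective_atomic_jump m A S' :
  effective orc m A -> effective orc m S' ->
  effective orc m (fun i l => atomic_jump (x i) (A i l) (S' i l)).
Proof.
  intros HA HS. apply effective_refutation; [exact HA | | exact HS].
  now apply effective_candidate.
Qed.

End EffectiveAtomic.

Lemma atomic_choice_spec x w :
  witness Atomic x w -> forall a, unrefuted (atomic_theta x a) (skolem w a).
Proof.
  intros Hw a c. apply atomic_theta_zero, atomic_at_iff. exact (all_ex_all_elim _ _ _ Hw a c).
Qed.

Lemma atomic_refutation_spec x w :
  witness (dual Atomic) x w -> forall b, exists c, atomic_theta x (w 0) b c <> 0.
Proof.
  intros Hw b. exists (skolem (behead w) b). intros H0.
  apply (ex_all_ex_elim _ _ _ Hw b), matrix_char_zero, H0.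
Qed.

Lemma atomic_to_cofin_zero : dm_reducible Atomic cofin_zero.
Proof.
  apply (reducible_to_cofin_zero Atomic (fun x k => atomic_jump x (pfst k) (psnd k))).
  { intros I orc x Hx Hcode. apply effective_fun_intro.
    apply effective_atomic_jump; try assumption; effectivity. }
  intros Hh.
  set (h := fun x => binary (fun k => atomic_jump x (pfst k) (psnd k))) in *.
  assert (Hmat : forall x n m,
    matrix_holds cofin_zero_matrix (h x) [n; m] <-> atomic_jump x n m = 0).
  { intros x n m. unfold h. rewrite cofin_zero_holds. now rewrite Cantor.cancel_of_to. }
  split; [| split; [| split]].
  (* The candidate of stage [s] is tested only at the [c] chosen below the candidate itself. This is
     decidable, and by [atomic_at_choice] a candidate that passes is never refuted. *)
  - set (next := fun x w a s => skolem w (candidate (atomic_theta x a) s)).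
    set (T := fun x w a => mu (fun s =>
      atomic_theta x a (candidate (atomic_theta x a) s) (next x w a s))).
    assert (Hex : forall x w a, witness Atomic x w ->
      exists s, atomic_theta x a (candidate (atomic_theta x a) s) (next x w a s) = 0).
    { intros x w a Hw.
      destruct (candidate_reaches _ _ (atomic_choice_spec x w Hw a)) as [s Hs].
      exists s. apply Hs. }
    apply (translates_all_cofin _ _ _ _ Hh T).
    + intros I orc x w Hx Hw Hcx Hcw. apply effective_fun_intro.
      pose proof (effective_skolem orc w Hcw) as Hsk.
      apply (effective_mu orc 1 (fun i s l => atomic_theta (x i) (nth 0 l 0)
        (candidate (atomic_theta (x i) (nth 0 l 0)) s) (next (x i) (w i) (nth 0 l 0) s))).
      * unfold next. cbv beta.
        assert (effective orc 2 (fun i l =>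
          candidate (atomic_theta (x i) (nth 0 (tl l) 0)) (nth 0 l 0))).
        { apply effective_candidate; try assumption; effectivity. }
        apply effective_atomic_theta; try assumption; effectivity; assumption.
      * intros i l. apply Hex, Hw.
    + intros x w Hx Hw n m Hm. apply Hmat.
      apply (no_jump_of_unrefuted _ (T x w n)); [| exact Hm].
      intros c. apply atomic_theta_zero, (atomic_at_choice x (skolem w)).
      * apply Hx.
      * intros a c'. apply atomic_theta_zero, atomic_choice_spec, Hw.
      * apply atomic_theta_zero. exact (proj1 (mu_spec _ (Hex x w n Hw))).
  (* Beyond the threshold there are no jumps, so the candidate at the threshold is unrefuted. *)
  - apply (translates_all_ex_all _ _ _ (fun x => x) (effective_map_id _)
      (fun x w a => candidate (atomic_theta x a) (skolem w a))).
    + intros I orc x w Hx Hw Hcx Hcw. apply effective_fun_intro.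
      pose proof (effective_skolem orc w Hcw) as Hsk.
      apply effective_candidate; try assumption; effectivity.
    + intros x w Hx Hw a c. apply matrix_char_zero.
      apply (unrefuted_of_no_jump (atomic_theta x a)). intros s Hs.
      exact (proj1 (Hmat x a s) (all_cofin_elim _ _ _ Hw a s Hs)).
  (* The same element [a] is used; as every [b] is refuted below it, a search for the next jump
     always ends. *)
  - apply (translates_ex_inf _ _ _ _ Hh (fun _ w => w 0)
      (fun x w => first_nonzero_from (atomic_jump x (w 0)))).
    + apply effective_on_head.
    + intros I orc x w Hx Hw Hcx Hcw. apply effective_first_nonzero_from.
      * apply effective_fun_intro. apply effective_atomic_jump; try assumption; effectivity.
      * intros i. apply jumps_of_refuted, atomic_refutation_spec, Hw.
    + intros x w Hx Hw m.
      destruct (first_nonzero_from_spec (atomic_jump x (w 0)) m) as [H1 H2].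
      { apply jumps_of_refuted, atomic_refutation_spec, Hw. }
      split; [exact H1 |]. intros H0. exact (H2 (proj1 (Hmat x _ _) H0)).
  (* The given jumps beyond every stage show that each [b] has a refutation, which can then be
     searched for. *)
  - set (C := fun x w b => mu (fun c => 1 - atomic_theta x (w 0) b c)).
    assert (Hex : forall x w b, witness (dual cofin_zero) (h x) w ->
      exists c, 1 - atomic_theta x (w 0) b c = 0).
    { intros x w b Hw.
      destruct (refuted_of_jumps (atomic_theta x (w 0))) with (b := b) as [c Hc].
      - intros t. exists (skolem (behead w) t).
        destruct (ex_inf_elim _ _ _ Hw t) as [Ht Hnot]. split; [exact Ht |].
        intros H0. exact (Hnot (proj2 (Hmat x _ _) H0)).
      - exists c. lia. }
    apply (translates_ex_all_ex _ _ _ (fun x => x) (effective_map_id _) (fun _ w => w 0) C).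
    + apply effective_on_head.
    + intros I orc x w Hx Hw Hcx Hcw. apply effective_fun_intro.
      apply (effective_mu orc 1 (fun i c l => 1 - atomic_theta (x i) (w i 0) (nth 0 l 0) c)).
      * apply effective_sub; [apply effective_const |].
        apply effective_atomic_theta; try assumption; effectivity.
      * intros i l. apply Hex, Hw.
    + intros x w Hx Hw b Hb. apply matrix_char_zero in Hb.
      pose proof (proj1 (mu_spec _ (Hex x w b Hw))) as H1.
      unfold C in Hb. unfold atomic_theta at 1 in H1. rewrite Hb in H1. discriminate.
Qed.

(** * Reducing eventual zeros to atomicity *)

Section Chains.

Context (y : baire).

Definition node (n s : nat) : nat := S (pair_code n s).

(** Index 0 always belongs to the chain, so that each chain has a top to which the question about
    atoms applies; [(n, m)] therefore corresponds to index [S m]. *)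
Definition chain_mem (n s : nat) : nat :=
  match s with 0 => 1 | S m => 1 - (1 - y (pair_code n m)) end.

Definition chains_carrier : baire := fun i =>
  match i with 0 => 1 | S p => chain_mem (pfst p) (psnd p) end.

(** The first factor tests that the chains agree, the second that the index of [j] is at most that
    of [i]: larger indices lie lower. Membership is added in [chains_order]. *)
Definition chains_below (i j : nat) : nat :=
  match i with
  | 0 => 1
  | S p =>
      match j with
      | 0 => 0
      | S q => (1 - ((pfst p - pfst q) + (pfst q - pfst p))) * (1 - (psnd q - psnd p))
      end
  end.

Definition chains_order : baire := fun r =>
  chains_carrier (pfst r) * chains_carrier (psnd r) * chains_below (pfst r) (psnd r).

(* 0 is the bottom; the other elements form one descending chain for each [n],
   which is extended by [node n (S m)] whenever [y] is non-zero at [(n, m)]. *)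
Definition chains : instance := ([0], [chains_carrier; chains_order]).

(** The largest index up to [N] that occurs in chain [n]; the initial value 0 is the top. *)
Definition chains_last (n N : nat) : nat :=
  nat_rect (fun _ => nat) 0
    (fun m s => match y (pair_code n m) with 0 => s | S _ => S m end) N.

Lemma node_cases i : i = 0 \/ exists n s, i = node n s.
Proof.
  destruct i as [| p]; [now left |]. right. exists (pfst p), (psnd p). unfold node.
  now rewrite <- surjective_pairing, Cantor.cancel_to_of.
Qed.

Lemma node_inj n s n' s' : node n s = node n' s' -> n = n' /\ s = s'.
Proof.
  intros H. apply Nat.succ_inj, Cantor.to_nat_inj in H. now injection H.
Qed.

Lemma chains_carrier_node n s : chains_carrier (node n s) = chain_mem n s.
Proof. unfold chains_carrier, node. now rewrite Cantor.cancel_of_to. Qed.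

Lemma chains_carrier_le i : chains_carrier i <= 1.
Proof.
  destruct i as [| p]; [exact (le_n 1) |]. simpl. unfold chain_mem. destruct (psnd p); lia.
Qed.

Lemma chains_below_node n s n' s' :
  chains_below (node n s) (node n' s') = 1 <-> n = n' /\ s' <= s.
Proof.
  unfold chains_below, node. rewrite !Cantor.cancel_of_to. cbn [fst snd].
  rewrite Nat.mul_eq_1. lia.
Qed.

Lemma chains_below_le i j : chains_below i j <= 1.
Proof.
  unfold chains_below. destruct i as [| p]; [lia |]. destruct j as [| q]; [lia |].
  apply (Nat.mul_le_mono _ 1 _ 1); lia.
Qed.

Lemma chains_order_iff i j :
  chains_order (pair_code i j) = 1 <->
  chains_carrier i = 1 /\ chains_carrier j = 1 /\ chains_below i j = 1.
Proof.
  unfold chains_order. rewrite Cantor.cancel_of_to. cbn [fst snd].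
  rewrite !Nat.mul_eq_1. tauto.
Qed.

Lemma chains_poset : is_poset_with_bottom chains.
Proof.
  unfold is_poset_with_bottom, chains. cbn [fst snd nth]. repeat split.
  - apply chains_carrier_le.
  - intros r. unfold chains_order.
    pose proof (chains_carrier_le (pfst r)). pose proof (chains_carrier_le (psnd r)).
    pose proof (chains_below_le (pfst r) (psnd r)).
    apply (Nat.mul_le_mono _ 1 _ 1); [apply (Nat.mul_le_mono _ 1 _ 1) |]; assumption.
  - now apply chains_order_iff in H.
  - now apply chains_order_iff in H.
  - intros a Ha. apply chains_order_iff. split; [exact Ha |]. split; [exact Ha |].
    destruct (node_cases a) as [-> | (n & s & ->)]; [reflexivity |].
    apply chains_below_node. auto.
  - intros a b Hab Hba. apply chains_order_iff in Hab as (_ & _ & Hab).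
    apply chains_order_iff in Hba as (_ & _ & Hba).
    destruct (node_cases a) as [-> | (n & s & ->)], (node_cases b) as [-> | (m & t & ->)];
      try reflexivity; try discriminate.
    apply chains_below_node in Hab, Hba. destruct Hab as [<- Hts].
    now replace t with s by lia.
  - intros a b c Hab Hbc. apply chains_order_iff in Hab as (Ha & Hb & Hab).
    apply chains_order_iff in Hbc as (_ & Hc & Hbc). apply chains_order_iff.
    split; [exact Ha |]. split; [exact Hc |].
    destruct (node_cases a) as [-> | (n & s & ->)]; [reflexivity |].
    destruct (node_cases b) as [-> | (m & t & ->)]; [discriminate |].
    destruct (node_cases c) as [-> | (k & u & ->)]; [discriminate |].
    apply chains_below_node in Hab as [-> H1], Hbc as [-> H2].
    apply chains_below_node. split; [reflexivity | lia].
  - intros a Ha. apply chains_order_iff. repeat split. exact Ha.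
Qed.

Lemma chain_mem_succ n m : chain_mem n (S m) = 1 <-> y (pair_code n m) <> 0.
Proof. cbn [chain_mem]. lia. Qed.

Lemma chains_last_spec n N :
  chains_last n N <= N /\ chain_mem n (chains_last n N) = 1 /\
  forall s, s <= N -> chain_mem n s = 1 -> s <= chains_last n N.
Proof.
  induction N as [| N (H1 & H2 & H3)]; [now repeat split |].
  change (chains_last n (S N)) with
    (match y (pair_code n N) with 0 => chains_last n N | S _ => S N end).
  destruct (y (pair_code n N)) as [| v] eqn:Hy.
  - split; [lia |]. split; [exact H2 |]. intros s Hs Hmem.
    destruct (Nat.eq_dec s (S N)) as [-> | Hne]; [| apply H3; [lia | exact Hmem]].
    now apply chain_mem_succ in Hmem.
  - split; [lia |]. split; [| auto]. apply chain_mem_succ. lia.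
Qed.

(** No index above [N] occurs, so the last one up to [N] is the least element of the chain; [s <= N]
    places it below [node n s]. *)
Lemma chains_last_atom n N s :
  (forall m, N <= m -> y (pair_code n m) = 0) -> s <= N ->
  forall c, atomic_at chains (node n s) (node n (chains_last n N)) c.
Proof.
  intros Hzero Hs c. unfold atomic_at, chains. cbn [fst snd nth]. intros Ha.
  destruct (chains_last_spec n N) as (H1 & H2 & H3).
  rewrite chains_carrier_node. split; [exact H2 |]. intros Hc _.
  rewrite !chains_order_iff, !chains_carrier_node, !chains_below_node.
  rewrite chains_carrier_node in Ha.
  split; [repeat split; auto; discriminate |].
  intros [[_ Hc0] [(_ & _ & Hlt) Hne]].
  destruct (node_cases c) as [-> | (m & t & ->)]; [now apply Hc0 |].
  apply chains_below_node in Hlt as [-> Hlt]. rewrite chains_carrier_node in Hc.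
  apply Hne. f_equal. apply Nat.le_antisymm; [| exact Hlt].
  destruct (le_dec t N) as [Ht | Ht]; [now apply H3 |].
  (* An index above [N] has the form [S t] with [N <= t], where [y] vanishes. *)
  destruct t as [| t]; [lia |]. apply chain_mem_succ in Hc. elim Hc. apply Hzero. lia.
Qed.

(** An element other than the bottom and below [node n s] lies on the same chain, and [node n (S m)]
    with [t <= m] would refute it. This serves both to bound the non-zero values by an atom and to
    refute alleged atoms. *)
Lemma chains_below_element n s b c :
  chain_mem n s = 1 -> chains_carrier c = 1 -> atomic_at chains (node n s) b c ->
  exists t, b = node n t /\ forall m, t <= m -> c <> node n (S m).
Proof.
  intros Hs Hc H. unfold atomic_at, chains in H. cbn [fst snd nth] in H.
  rewrite !chains_order_iff, chains_carrier_node in H.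
  destruct (H Hs) as [Hb Hb']. destruct (Hb' Hc) as [[[_ Hb0] (_ & _ & Hba)] Hno].
  { now repeat split. }
  destruct (node_cases b) as [-> | (m & t & ->)]; [now elim Hb0 |].
  apply chains_below_node in Hba as [-> _]. exists t. split; [reflexivity |].
  rewrite chains_carrier_node in Hb.
  intros m Hm ->. apply Hno. split.
  - now repeat split.
  - split.
    + split; [exact Hc |]. rewrite chains_carrier_node, chains_below_node. auto.
    + intros Heq. apply node_inj in Heq. lia.
Qed.

(** [psnd (pred b)] is the index of the atom [b]; a non-zero value at some [m] not below it would
    yield a member strictly below [b]. *)
Lemma chains_atom_bound n b :
  (forall c, atomic_at chains (node n 0) b c) ->
  forall m, psnd (pred b) <= m -> y (pair_code n m) = 0.
Proof.
  intros H m Hm. apply NNPP. intros Hy.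
  destruct (chains_below_element n 0 b (node n (S m))) as (t & -> & Ht).
  - reflexivity.
  - rewrite chains_carrier_node. now apply chain_mem_succ.
  - apply H.
  - apply (Ht m); [| reflexivity]. cbn [node pred] in Hm.
    rewrite Cantor.cancel_of_to in Hm. exact Hm.
Qed.

(** The refuting element depends on [b] only through [psnd (pred b)], which makes sense for every
    number. If [b] is not on chain [n], the matrix already fails because [b] is no non-bottom
    element below the top of the chain. *)
Lemma chains_not_atomic n (K : baire) :
  (forall m, m <= K m /\ y (pair_code n (K m)) <> 0) ->
  forall b, ~ atomic_at chains (node n 0) b (node n (S (K (psnd (pred b))))).
Proof.
  intros HK b H.
  destruct (chains_below_element n 0 b (node n (S (K (psnd (pred b))))))
    as (t & -> & Ht).
  - reflexivity.
  - rewrite chains_carrier_node. apply chain_mem_succ, HK.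
  - exact H.
  - apply (Ht (K (psnd (pred (node n t))))); [| reflexivity].
    cbn [node pred]. rewrite Cantor.cancel_of_to. apply HK.
Qed.

Lemma chains_not_atomic_inf a :
  (forall b, exists c, ~ atomic_at chains a b c) ->
  forall k, exists j, y (pair_code (pfst (pred a)) (k + j)) <> 0.
Proof.
  intros H k. destruct (node_cases a) as [-> | (n & s & ->)].
  (* The bottom cannot be a counterexample: for it the choice 0 satisfies the matrix vacuously. *)
  - destruct (H 0) as [c Hc]. elim Hc. intros _. split; [reflexivity |].
    intros _ [_ H0]. now elim H0.
  - cbn [node pred]. rewrite Cantor.cancel_of_to. cbn [fst].
    apply NNPP. intros Hno.
    (* The summand [s] ensures that the search for the last index reaches [node n s]. *)
    destruct (H (node n (chains_last n (k + s)))) as [c Hc]. apply Hc, chains_last_atom; [| lia].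
    intros m Hm. apply NNPP. intros Hy. apply Hno. exists (m - k).
    now replace (k + (m - k)) with m by lia.
Qed.

End Chains.

Section EffectiveChains.

Context {I : Type} (orc : I -> baire) (y : I -> baire).
Hypothesis effective_y : effective_fun orc y.

Lemma effective_chains_carrier k E :
  effective orc k E -> effective orc k (fun i l => chains_carrier (y i) (E i l)).
Proof.
  intros HE. refine (effective_fun_app orc (fun i => chains_carrier (y i)) k E _ HE).
  apply effective_fun_intro. unfold chains_carrier, chain_mem. effectivity.
Qed.

Lemma effective_chains_order : effective_fun orc (fun i => chains_order (y i)).
Proof.
  apply effective_fun_intro. unfold chains_order.
  apply effective_mul; [apply effective_mul; apply effective_chains_carrier; effectivity |].
  unfold chains_below. effectivity.
Qed.

Lemma effective_chains : effective_fun orc (fun i => code (chains (y i))).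
Proof.
  apply (effective_ncons orc 0 (fun _ _ => 0)); [apply effective_const |].
  apply effective_bpair; [| apply effective_bpair; [exact effective_chains_order |]].
  - apply (effective_chains_carrier 1 (fun _ l => nth 0 l 0)). effectivity.
  - exact (effective_const orc 1 0).
Qed.

Lemma effective_chains_last k E F :
  effective orc k E -> effective orc k F ->
  effective orc k (fun i l => chains_last (y i) (E i l) (F i l)).
Proof.
  intros HE HF. apply (effective_rec orc k (fun _ _ => 0)
    (fun i m s l => match y i (pair_code (E i l) m) with 0 => s | S _ => S m end) F);
    [apply effective_const | | exact HF].
  apply (effective_match orc (S (S k)) (fun i l => y i (pair_code (E i (tl (tl l))) (nth 0 l 0)))
    (fun _ l => nth 1 l 0) (fun _ _ l => S (nth 0 l 0))); [| effectivity | effectivity].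
  apply (effective_fun_app orc y); [exact effective_y |].
  apply effective_pair; [| apply effective_nth].
  exact (effective_tl _ _ _ (effective_tl _ _ _ HE)).
Qed.

End EffectiveChains.

Definition seq_of (x : instance) : baire := nth 0 (snd x) (fun _ => 0).

Lemma effective_seq_of : effective_map (is_instance cofin_zero) seq_of.
Proof.
  intros I orc x Hx Hcode.
  exact (effective_instance_fun orc x 0 1 (fun i => proj1 (Hx i))
    (fun i => proj1 (proj2 (Hx i))) Hcode 0).
Qed.

Lemma cofin_zero_to_atomic : dm_reducible cofin_zero Atomic.
Proof.
  set (h := fun x => chains (seq_of x)).
  assert (Hh : effective_map (is_instance cofin_zero) (fun x => code (h x))).
  { intros I orc x Hx Hcode. now apply (effective_chains orc (fun i => seq_of (x i))),
      effective_seq_of. }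
  apply (dm_reducible_intro cofin_zero Atomic h Hh).
  - intros x Hx. split; [reflexivity |]. split; [reflexivity |]. split.
    + constructor; [| constructor; [| constructor]].
      * refine (effective_map_computable _ (fun x => chains_carrier (seq_of x)) x _ Hx
          (proj1 (proj2 (proj2 Hx)))).
        intros I orc z Hz Hcode.
        apply (effective_chains_carrier orc (fun i => seq_of (z i))); [| apply effective_nth].
        now apply effective_seq_of.
      * refine (effective_map_computable _ (fun x => chains_order (seq_of x)) x _ Hx
          (proj1 (proj2 (proj2 Hx)))).
        intros I orc z Hz Hcode.
        apply (effective_chains_order orc (fun i => seq_of (z i))). now apply effective_seq_of.
    + apply chains_poset.
  (* The matrix demands a choice in the carrier even for the bottom, hence the value 0 there.
     Otherwise the bound is the threshold plus the index of [a], so that the chosen element is below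
     [a]. *)
  - apply (translates_all_ex_all _ _ _ _ Hh (fun x w a => match a with 0 => 0 | S p =>
      node (pfst p) (chains_last (seq_of x) (pfst p) (skolem w (pfst p) + psnd p)) end)).
    + intros I orc x w Hx Hw Hcx Hcw. apply effective_fun_intro.
      pose proof (effective_skolem orc w Hcw) as Hsk.
      pose proof (effective_seq_of I orc x Hx Hcx) as Hy.
      apply (effective_match orc 1 (fun _ l => nth 0 l 0) (fun _ _ => 0) (fun i p _ =>
        node (pfst p) (chains_last (seq_of (x i)) (pfst p) (skolem (w i) (pfst p) + psnd p))));
        [effectivity | effectivity |].
      apply effective_succ, effective_pair; [effectivity |].
      apply (effective_chains_last orc (fun i => seq_of (x i)) Hy); effectivity.
    + intros x w Hx Hw a c. apply atomic_at_iff.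
      destruct (node_cases a) as [-> | (n & s & ->)].
      * intros _. split; [reflexivity |]. intros _ [_ H0]. now elim H0.
      * cbn [node]. rewrite Cantor.cancel_of_to. cbn [fst snd].
        apply chains_last_atom; [| lia].
        intros m Hm. apply (all_cofin_elim _ _ _ Hw n m). lia.
  (* The threshold is the index of the atom chosen below the top of chain [n]. *)
  - apply (translates_all_cofin _ _ _ (fun x => x) (effective_map_id _)
      (fun _ w n => psnd (pred (skolem w (node n 0))))).
    + intros I orc x w Hx Hw Hcx Hcw. apply effective_fun_intro.
      pose proof (effective_skolem orc w Hcw) as Hsk. unfold node. effectivity.
    + intros x w Hx Hw n m Hm. refine (chains_atom_bound _ n _ _ m Hm).
      intros c. exact (proj1 (atomic_at_iff _ _ _ _) (all_ex_all_elim _ _ _ Hw (node n 0) c)).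
  (* The top of an infinite chain is the counterexample; an alleged atom with index [t] is refuted
     by a member coming from a non-zero value at a place not below [t]. *)
  - apply (translates_ex_all_ex _ _ _ _ Hh (fun _ w => node (w 0) 0)
      (fun x w b => node (w 0) (S (skolem (behead w) (psnd (pred b)))))).
    + intros I orc x w Hx Hw Hcx Hcw. apply effective_fun_intro. unfold node. effectivity.
    + intros I orc x w Hx Hw Hcx Hcw. apply effective_fun_intro.
      pose proof (effective_skolem orc _ (effective_behead orc w Hcw)) as Hsk.
      unfold node. effectivity.
    + intros x w Hx Hw b Hb.
      refine (chains_not_atomic (seq_of x) (w 0) (skolem (behead w)) _ b
        (proj1 (atomic_at_iff _ _ _ _) Hb)).
      exact (ex_inf_elim _ _ _ Hw).
  (* The element without an atom determines its chain; the non-zero values there are unbounded and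
     hence found by search. *)
  - assert (Hex : forall x w, witness (dual Atomic) (h x) w ->
      forall k, exists j, seq_of x (pair_code (pfst (pred (w 0))) (k + j)) <> 0).
    { intros x w Hw. apply chains_not_atomic_inf. intros b. exists (skolem (behead w) b).
      intros H. exact (ex_all_ex_elim _ _ _ Hw b (proj2 (atomic_at_iff _ _ _ _) H)). }
    apply (translates_ex_inf _ _ _ (fun x => x) (effective_map_id _)
      (fun _ w => pfst (pred (w 0)))
      (fun x w => first_nonzero_from (fun m => seq_of x (pair_code (pfst (pred (w 0))) m)))).
    + intros I orc x w Hx Hw Hcx Hcw. apply effective_fun_intro. effectivity.
    + intros I orc x w Hx Hw Hcx Hcw. apply effective_first_nonzero_from.
      * pose proof (effective_seq_of I orc x Hx Hcx) as Hy.
        apply effective_fun_intro. effectivity.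
      * intros i. now apply Hex.
    + intros x w Hx Hw m.
      exact (first_nonzero_from_spec (fun m => seq_of x (pair_code (pfst (pred (w 0))) m)) m
        (Hex x w Hw m)).
Qed.

Theorem theorem3p14 : dicomplete [QAll; QAllInf] Atomic.
Proof.
  exists cofin_zero. split; [exact cofin_zero_strictly_dicomplete |].
  split; [exact atomic_to_cofin_zero | exact cofin_zero_to_atomic].
Qed.
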